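(* If $K$ is a Legendrian knot in $\mathbb{R}^3$ with $\deg R_K(z)\ge0$ (i.e., $K$ has an (ungraded) normal ruling where the number of switches is at least the number of right cusps), then $K$ is $A_{(2)}$-compatible, i.e. $R_{S(K,A_{(2)})}(z)\ne R_{A_{(2)}}(z)$.
   Context: **Legendrian links.** $\mathbb{R}^3$ and $J^1(S^1)=S^1\times\mathbb{R}^2$ carry coordinates $(x,y,z)$ and the contact structure $\ker(dz-y\,dx)$. The front of a Legendrian link is its image under $(x,y,z)\mapsto(x,z)$; the same letter denotes a link and its front. Generically a front is a union of closed curves without vertical tangencies, immersed except at semicubical cusps, with only transverse double points (crossings). Fronts in $J^1(S^1)$ lie in the annulus $[0,1]\times\mathbb{R}$ with $x=0$ and $x=1$ identified. **Pattern.** $A_{(2)}=A_2\subset J^1(S^1)$ is the Legendrian knot without cusps whose front is the closure of the $2$-strand braid with a single crossing. **Satellite.** Let $(K,* )$ be an oriented connected Legendrian knot with base point away from cusps and crossings, and let $L\subset J^1(S^1)$ have generic front with singularities away from $x=0$, meeting $x=0$ in $n$ points. Take $n$ copies of the front of $K$, each successive one shifted slightly downward in $z$. Cut the front of $L$ open along $x=0$, scale it, and insert it into the $n$ parallel strands at the location of $*$, directly if $K$ is oriented to the right at $*$, and reflected across a vertical axis if it is oriented to the left. The result is the front of $S(K,L)\subset\mathbb{R}^3$, whose Legendrian isotopy type depends only on those of $K$ and $L$. Fronts are perturbed by planar isotopy so that all crossings and cusps have distinct $x$-coordinates. **Normal rulings.** Let $F$ be a front in $M\times\mathbb{R}$,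 $M=\mathbb{R}$ or $S^1$, with all crossings and cusps at distinct $x$-coordinates, let $\pi(x,z)=x$, and let $\Sigma\subset M$ be the set of $x$-coordinates of crossings and cusps. A normal ruling is a continuous fixed-point-free involution $\rho$ of $F\setminus\pi^{-1}(\Sigma)$ with $\pi\circ\rho=\pi$ such that: (a) near a cusp, $\rho$ interchanges the two branches of the cusp, and on the remaining strands it is the same on both sides; (b) strands meeting at a crossing are not paired by $\rho$; (c) near a crossing at $x_0$, over a small interval $N\ni x_0$, $F$ is covered by continuous sections $f_i:N\to F$ ($\pi\circ f_i=\mathrm{id}$), each point other than the crossing lying on exactly one section and the crossing on exactly two, such that away from $x_0$ each $\rho\circ f_i$ equals some $f_j$. The two sections through the crossing either cross transversely following the diagram, or each turns a corner there, one covering the upper half and the other the lower half of the crossing; in the latter case the crossing is a switch; (d) (normality) near a switch, the two vertical intervals joining each switching strand to the strand paired with it are either disjoint or nested. The (ungraded, i.e. $1$-graded) ruling polynomial is $R(z)=\sum_\rho z^{j(\rho)}$ over all normal rulings, with $j(\rho)=\#\text{switches}-\#\text{right cusps}$; it is a Legendrian isotopy invariant. *)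

(* Defs.v *)
From mathcomp Require Import all_boot all_order all_algebra zify.
From mathcomp Require Import constructive_ereal.
From mathcomp.multinomials Require Import freeg.

Set Implicit Arguments.
Unset Strict Implicit.
Unset Printing Implicit Defensive.

Import GRing.Theory.

(** A generic front whose cusps and crossings have distinct [x]-coordinates is
    recorded, up to planar isotopy, by the sequence of these singularities read
    from left to right.  Over each complementary interval the strands are
    numbered [0], [1], [2]... from top to bottom (decreasing [z]).  [LeftCusp k]
    creates the strands [k] and [k.+1], [RightCusp k] joins the strands [k] and
    [k.+1], and [Crossing k] exchanges them. *)

Variant event := LeftCusp of nat | RightCusp of nat | Crossing of nat.

Definition is_right_cusp (e : event) : bool :=
  if e is RightCusp _ then true else false.

Definition event_ok (e : event) (m : nat) : bool :=
  match e with
  | LeftCusp k => k <= m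
  | RightCusp k | Crossing k => k.+1 < m
  end.

Definition step (m : nat) (e : event) : nat :=
  match e with
  | LeftCusp _ => m.+2
  | RightCusp _ => m.-2
  | Crossing _ => m
  end.

Definition width (m : nat) (w : seq event) : nat := foldl step m w.

Fixpoint wf (m : nat) (w : seq event) : bool :=
  if w is e :: w' then event_ok e m && wf (step m e) w' else true.

(** [front m] is the type of fronts in the annulus meeting the line [x = 0],
    along which the annulus is cut open, in [m] nonsingular points.  A front in
    the plane is the same thing as a front in the annulus avoiding [x = 0], so
    [front 0] is also the type of fronts of Legendrian links in R^3. *)
Record front (m : nat) := Front {
  events :> seq event;
  _ : wf m events && (width m events == m) }.

Section Front.
Variables (m : nat) (F : front m).

(** [i : 'I_(size F).+1] stands for the [i]-th interval of the complement of
    the singular [x]-coordinates.  Intervals [0] and [size F] are the two sides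
    of the cut [x = 0]; they are glued in [glued] and [is_ruling] below. *)
Definition nstrands (i : 'I_(size F).+1) : nat := width m (take i F).

Definition strand : Type := {i : 'I_(size F).+1 & 'I_(nstrands i)}.

Definition event_at (i : 'I_(size F)) : event := tnth (in_tuple F) i.
Definition before (i : 'I_(size F)) : 'I_(size F).+1 := widen_ord (leqnSn _) i.
Definition after (i : 'I_(size F)) : 'I_(size F).+1 := fintype.lift ord0 i.

End Front.

Definition skip (k j : nat) : nat := if j < k then j else j.+2.

Definition swap (k j : nat) : nat :=
  if j == k then k.+1 else if j == k.+1 then k else j.

(** [through e j j'] holds when strand [j] on the left of [e] continues as
    strand [j'] on its right, following the diagram. *)
Definition through (e : event) : rel nat := fun j j' =>
  match e with
  | LeftCusp k => j' == skip k j
  | RightCusp k => j == skip k j'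
  | Crossing k => j' == swap k j
  end.

Section Knot.
Variables (m : nat) (F : front m).

Definition glued (s t : strand F) : bool :=
  [|| [exists i : 'I_(size F), [&& tag s == before i, tag t == after i
        & through (event_at i) (tagged s) (tagged t)]]
    | [&& tag s == ord_max, tag t == ord0 & tagged s == tagged t :> nat]].

Definition branches (i : 'I_(size F).+1) (k : nat) (s t : strand F) : bool :=
  [&& tag s == i, tag t == i, tagged s == k :> nat & tagged t == k.+1 :> nat].

Definition cusped (s t : strand F) : bool :=
  [exists i : 'I_(size F),
    match event_at i with
    | LeftCusp k => branches (after i) k s t
    | RightCusp k => branches (before i) k s t
    | Crossing _ => false
    end].

Definition adjacent : rel (strand F) :=
  fun s t => [|| glued s t, glued t s, cusped s t | cusped t s].

Definition is_knot : bool :=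
  (0 < #|{: strand F}|) && [forall s, forall t, connect adjacent s t].

(** [o s] says that the strand [s] is oriented to the right. *)
Definition is_orientation (o : strand F -> bool) : Prop :=
  (forall s t, glued s t -> o s = o t) /\
  (forall s t, cusped s t -> o s = ~~ o t).

End Knot.

Section LocalConditions.
Variables (m n : nat) (p : {ffun 'I_m -> 'I_m}) (q : {ffun 'I_n -> 'I_n}).

Definition paired (k l : nat) : bool :=
  [exists a : 'I_m, exists b : 'I_m,
    [&& a == k :> nat, b == l :> nat & p a == b]].

(** [sec j j'] says that some section over a neighborhood of the singularity
    consists of strand [j] on the left and of strand [j'] on the right; [p]
    and [q], the involutions on the two sides, carry sections to sections. *)
Definition respects (sec : rel nat) : bool :=
  [forall j : 'I_m, forall j' : 'I_n, sec j j' ==> sec (p j) (q j')].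

Definition disjoint_itv (a a' b b' : nat) : bool :=
  (maxn a a' < minn b b') || (maxn b b' < minn a a').

Definition nested_itv (a a' b b' : nat) : bool :=
  (minn a a' <= minn b b') && (maxn b b' <= maxn a a') ||
  (minn b b' <= minn a a') && (maxn a a' <= maxn b b').

Definition normal_at (k : nat) : bool :=
  [forall a : 'I_m, forall b : 'I_m, (a == k :> nat) && (b == k.+1 :> nat) ==>
    (disjoint_itv a (p a) b (p b) || nested_itv a (p a) b (p b))].

End LocalConditions.

(** At a switch both sections turn a corner, so that strand [j] on the left
    forms a section with strand [j] on the right, for every [j]. *)
Definition ruled_at (e : event) (m n : nat)
    (p : {ffun 'I_m -> 'I_m}) (q : {ffun 'I_n -> 'I_n}) : bool :=
  match e with
  | LeftCusp k => paired q k k.+1 && respects p q (through e)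
  | RightCusp k => paired p k k.+1 && respects p q (through e)
  | Crossing k =>
      [&& ~~ paired p k k.+1, ~~ paired q k k.+1
        & respects p q (through e) || respects p q eq_op && normal_at p k]
  end.

Section Ruling.
Variables (m : nat) (F : front m).

(** Continuity makes an involution of the front minus its singular fibers over
    the [x]-axis a permutation of the strands above each interval. *)
Definition fiberwise : finType :=
  {dffun forall i : 'I_(size F).+1,
     {ffun 'I_(nstrands i) -> 'I_(nstrands i)}}.

Definition is_ruling (rho : fiberwise) : bool :=
  [&& [forall i, forall j, (rho i (rho i j) == j) && (rho i j != j)],
      respects (rho ord_max) (rho ord0) eq_op
    & [forall i : 'I_(size F),
        ruled_at (event_at i) (rho (before i)) (rho (after i))]].

(** For a normal ruling, the alternatives of [ruled_at] at a crossing exclude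
    each other because the crossing strands are not paired. *)
Definition is_switch (rho : fiberwise) (i : 'I_(size F)) : bool :=
  if event_at i is Crossing _
  then respects (rho (before i)) (rho (after i)) eq_op else false.

Definition jdeg (rho : fiberwise) : int :=
  (#|[set i | is_switch rho i]|%:Z - (count is_right_cusp F)%:Z)%R.

(** Laurent polynomials form the free abelian group on the exponents; [<< d >>]
    is the monomial [z^d]. *)
Definition ruling_poly : {freeg int / int} :=
  (\sum_(rho : fiberwise | is_ruling rho) << jdeg rho >>)%R.

End Ruling.

Definition ldeg (P : {freeg int / int}) : \bar int :=
  \big[maxe/-oo%E]_(d <- dom P) d%:E%E.

Definition mirror_event (e : event) : event :=
  match e with
  | LeftCusp k => RightCusp k
  | RightCusp k => LeftCusp k
  | Crossing k => Crossing k
  end.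

Definition mirror (w : seq event) : seq event := rev (map mirror_event w).

(** In the [n]-copy, each copy being shifted downward from the previous one,
    strand [k] becomes the strands [n * k], ..., [n * k + n.-1], in the order of
    the copies.  At a crossing each copy of the lower strand crosses, in turn, all
    the copies of the upper one.  Right of the [n] left cusps, the upper branch
    of the [j]-th copy crosses the lower branches of the copies [j.-1], ..., [0],
    which lie above it at the cusps.  Right cusps are the reflected picture. *)
Definition copies_left_cusp (n k : nat) : seq event :=
  [seq LeftCusp (n * k + i.*2) | i <- iota 0 n] ++
  [seq Crossing (n * k + j + i) | j <- iota 0 n, i <- rev (iota 0 j)].

Definition copies (n : nat) (e : event) : seq event :=
  match e with
  | LeftCusp k => copies_left_cusp n k
  | RightCusp k => mirror (copies_left_cusp n k)
  | Crossing k =>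
      [seq Crossing (n * k + j + i) | j <- iota 0 n, i <- rev (iota 0 n)]
  end.

Definition ncopy (n : nat) (w : seq event) : seq event :=
  flatten (map (copies n) w).

Definition lower_event (d : nat) (e : event) : event :=
  match e with
  | LeftCusp k => LeftCusp (d + k)
  | RightCusp k => RightCusp (d + k)
  | Crossing k => Crossing (d + k)
  end.

Lemma width_cat m w1 w2 : width m (w1 ++ w2) = width (width m w1) w2.
Proof. by rewrite /width foldl_cat. Qed.

Lemma wf_cat m w1 w2 : wf m (w1 ++ w2) = wf m w1 && wf (width m w1) w2.
Proof. by elim: w1 m => //= e w1 IH m; rewrite IH andbA. Qed.

Lemma mirror_wf m w :
  wf m w -> wf (width m w) (mirror w) /\ width (width m w) (mirror w) = m.
Proof.
elim: w m => //= e w IH m /andP[em /IH[wfw ww]].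
rewrite /mirror /= rev_cons -cats1 wf_cat width_cat wfw.
rewrite -/(mirror w) -/(width (step m e) w) ww /= andbT.
by case: e em {wfw ww} => k /= ?; split=> //; lia.
Qed.

Lemma crossings_wf m s :
  all (fun k => k.+1 < m) s ->
  wf m (map Crossing s) /\ width m (map Crossing s) = m.
Proof. by elim: s => //= k s IH /andP[-> /IH]. Qed.

Lemma copies_left_cusp_wf n k m : k <= m ->
  wf (m * n) (copies_left_cusp n k) /\
  width (m * n) (copies_left_cusp n k) = m.+2 * n.
Proof.
move=> km.
have cusps r i : let w := [seq LeftCusp (n * k + j.*2) | j <- iota i r] in
    wf (m * n + i.*2) w /\ width (m * n + i.*2) w = m * n + (i + r).*2.
  elim: r i => [|r IH] i /=; first by rewrite addn0.
  have := IH i.+1; rewrite doubleS !addnS => -[-> ->]; rewrite andbT.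
  by split; nia.
have [] := cusps n 0; rewrite addn0 add0n => wf1 w1.
rewrite /copies_left_cusp wf_cat width_cat wf1 w1 /=.
have -> : m * n + n.*2 = m.+2 * n by nia.
rewrite -(map_allpairs Crossing (fun j i => n * k + j + i)).
apply: crossings_wf; apply/allP => x /allpairsPdep[j [i [+ + ->]]].
rewrite mem_rev !mem_iota; nia.
Qed.

Lemma copies_wf n e m : event_ok e m ->
  wf (m * n) (copies n e) /\ width (m * n) (copies n e) = step m e * n.
Proof.
case: e => k /= km; first exact: copies_left_cusp_wf.
  case: m km => [|[|m]] // km.
  by have [/mirror_wf[+ +] <-] := @copies_left_cusp_wf n k m km.
rewrite -(map_allpairs Crossing (fun j i => n * k + j + i)).
apply: crossings_wf; apply/allP => x /allpairsPdep[j [i [+ + ->]]].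
rewrite mem_rev !mem_iota; nia.
Qed.

Lemma ncopy_wf n m w : wf m w ->
  wf (m * n) (ncopy n w) /\ width (m * n) (ncopy n w) = width m w * n.
Proof.
elim: w m => //= e w IH m /andP[/(copies_wf n)[wf1 w1] /IH[wf2 w2]].
by rewrite /ncopy /= wf_cat width_cat w1 wf1.
Qed.

Lemma lower_wf d m r w : wf m w -> let w' := map (lower_event d) w in
  wf (d + m + r) w' /\ width (d + m + r) w' = d + width m w + r.
Proof.
elim: w m => //= e w IH m /andP[em /IH[wfw ww]].
have -> : step (d + m + r) (lower_event d e) = d + step m e + r.
  by case: e em {IH wfw ww} => k /=; lia.
by rewrite wfw ww andbT; split=> //; case: e em {IH wfw ww} => k /=; lia.
Qed.

Section Satellite.
Variables (K : front 0) (o : strand K -> bool) (star : strand K).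
Variables (n : nat) (L : front n).

Definition pattern : seq event := if o star then events L else mirror L.

(** The pattern is inserted into the [n] copies of the strand of the base point
    [star], hence below the copies of the [tagged star] strands above it. *)
Definition satellite_events : seq event :=
  ncopy n (take (tag star) K) ++
  map (lower_event (n * tagged star)) pattern ++
  ncopy n (drop (tag star) K).

Lemma pattern_wf : wf n pattern /\ width n pattern = n.
Proof.
rewrite /pattern; case: L => w /= /andP[wfw /eqP ww]; case: (o star) => //.
by have := mirror_wf wfw; rewrite ww.
Qed.

Lemma satellite_subproof :
  wf 0 satellite_events && (width 0 satellite_events == 0).
Proof.
have [wfp wp] := pattern_wf; rewrite /satellite_events.
have : wf 0 K && (width 0 K == 0) by case: (K).
rewrite -{1 2}(cat_take_drop (tag star) K) wf_cat width_cat.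
have := ltn_ord (tagged star); rewrite [X in _ < X]/nstrands.
set k : nat := tagged star; set w1 := take _ _; set w2 := drop _ _.
move=> ltk /andP[/andP[/(ncopy_wf n)[wf1 e1] /(ncopy_wf n)[wf2 e2]] /eqP e0].
rewrite mul0n in wf1 e1; rewrite !wf_cat !width_cat wf1 e1 /=.
have le : n * k + n <= width 0 w1 * n.
  by rewrite -mulnSr mulnC leq_mul2r ltk orbT.
have [] := lower_wf (n * k) (width 0 w1 * n - n * k - n) wfp; rewrite wp.
have -> : n * k + n + (width 0 w1 * n - n * k - n) = width 0 w1 * n.
  by rewrite -subnDA subnKC.
move=> -> ->.
by rewrite wf2 e2 e0.
Qed.

Definition satellite : front 0 := Front satellite_subproof.

Definition compatible : Prop := ruling_poly satellite <> ruling_poly L.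

End Satellite.

Definition A2 : front 2 := @Front 2 [:: Crossing 0] isT.

(* Main.v *)
Require Import Defs.
From mathcomp Require Import all_boot all_order all_algebra zify.
From mathcomp Require Import constructive_ereal.
From mathcomp.multinomials Require Import freeg.

Set Implicit Arguments.
Unset Strict Implicit.
Unset Printing Implicit Defensive.

(** The pattern has no normal ruling, since its two strands would be paired and
    yet cross ([no_ruling_A2]); so its ruling polynomial vanishes.  Ruling
    polynomials count rulings without signs, so it suffices to construct one
    normal ruling of the satellite, that is, of the two-copy of the knot with one
    more crossing, between the two copies of the strand of the base point.

    The construction starts from a ruling of the knot with at least as many
    switches as right cusps.  Over each interval, a pair of strands of this ruling
    gives two pairs in the two-copy, matched either as interleaved pairs or as
    nested ones ([doubled]); call the pair marked in the second case.  The local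
    question is how the marks may change.

    - Pairs are unmarked at cusps, and keep their marks along a crossing that is
      not a switch ([evolves_copies_left], [evolves_copies_right],
      [evolves_copies_unswitched]).
    - At the crossing of the pattern, the pair of the base point is marked on one
      side at least ([evolves_satellite_crossing]).
    - At a switch of the knot, four pairs come together, two on each side.  The
      four crossings of the two-copy can be resolved as soon as the number of
      marked pairs among them is not exactly one ([evolves_copies_kept],
      [evolves_copies_flipped]).

    So consider the graph whose vertices are the switches and cusps and whose
    edges are the maximal families of pairs that continue one another between
    them.  The marked pairs must form a subgraph without leaves, except that it has
    to meet the base point and may end there.  Such a subgraph is a cycle through
    the base point, or a path from the base point to a cycle.  The graph is
    connected because the knot is.  A family of pairs that starts at a left cusp,
    ends at a right cusp and meets [d] switches contributes two cusps and [d.+1]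
    edges, and every switch is met twice; hence the number of edges minus the
    number of vertices is the number of switches minus the number of right cusps.
    This is nonnegative, so there is a cycle, and connectivity joins it to the base
    point ([leafless_subgraph], [marks_exist]).

    In the formal graph every edge is subdivided, with one vertex for each pair
    over each interval.  This does not affect the count, and makes it local. *)

(** * Rulings as sequences of matchings of the natural numbers *)

(** The involutions of a ruling live over intervals with different numbers of
    strands, hence in different types; on plain functions, conjugating by a
    crossing or inserting a cusp needs no casts. *)
Definition matching (m : nat) (p : nat -> nat) : Prop :=
  forall j, j < m -> [/\ p j < m, p (p j) = j & p j <> j].

Definition carries (sec : rel nat) (m n : nat) (p q : nat -> nat) : Prop :=
  forall j j', j < m -> j' < n -> sec j j' -> sec (p j) (q j').

Definition switchable (p : nat -> nat) (k : nat) : bool :=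
  disjoint_itv k (p k) k.+1 (p k.+1) || nested_itv k (p k) k.+1 (p k.+1).

Definition ruled (e : event) (m n : nat) (p q : nat -> nat) : Prop :=
  match e with
  | LeftCusp k => q k = k.+1 /\ carries (through e) m n p q
  | RightCusp k => p k = k.+1 /\ carries (through e) m n p q
  | Crossing k =>
      [/\ p k <> k.+1, q k <> k.+1
        & carries (through e) m n p q \/
          carries eq_op m n p q /\ switchable p k]
  end.

Lemma ruled_ext e m n p q p' q' : n = step m e -> event_ok e m ->
  (forall j, j < m -> p j = p' j) -> (forall j, j < n -> q j = q' j) ->
  ruled e m n p q -> ruled e m n p' q'.
Proof.
move=> nE ok pp qq.
have cc sec : carries sec m n p q -> carries sec m n p' q'.
  by move=> c j j' jm jn /(c _ _ jm jn); rewrite pp ?qq.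
case: e ok nE => k /= ok nE.
- by case=> <- c; split; [rewrite qq //; lia | apply: cc].
- by case=> <- c; split; [rewrite pp //; lia | apply: cc].
have km := ltnW ok; subst n.
rewrite /switchable -!pp -?qq //.
by case=> ? ? [c|[c s]]; split=> //; [left|right; split=> //]; apply: cc.
Qed.

(** The default value [j] is never met below [m]. *)
Definition ext m (f : {ffun 'I_m -> 'I_m}) (j : nat) : nat :=
  if insub j is Some i then nat_of_ord (f i) else j.

Lemma ext_ord m (f : {ffun 'I_m -> 'I_m}) (i : 'I_m) : ext f i = f i.
Proof. by rewrite /ext valK. Qed.

Lemma extE m (f : {ffun 'I_m -> 'I_m}) j (jm : j < m) : ext f j = f (Ordinal jm).
Proof. by rewrite -ext_ord. Qed.

Lemma pairedE m (f : {ffun 'I_m -> 'I_m}) k l : k < m ->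
  paired f k l = (ext f k == l).
Proof.
move=> km; rewrite extE.
apply/existsP/eqP=> [[a /existsP[b /and3P[/eqP ak /eqP <- /eqP <-]]]|<-].
  by congr (nat_of_ord (f _)); apply/val_inj.
by exists (Ordinal km); apply/existsP; exists (f (Ordinal km)); rewrite !eqxx.
Qed.

Lemma respectsP m n (f : {ffun 'I_m -> 'I_m}) (g : {ffun 'I_n -> 'I_n}) sec :
  reflect (carries sec m n (ext f) (ext g)) (respects f g sec).
Proof.
apply: (iffP forallP) => [H j j' jm jn s|H j].
  rewrite !extE.
  by have /forallP/(_ (Ordinal jn))/implyP := H (Ordinal jm); apply.
apply/forallP=> j'; apply/implyP=> /(H j j' (ltn_ord j) (ltn_ord j')).
by rewrite !ext_ord.
Qed.

Lemma normal_atE m (f : {ffun 'I_m -> 'I_m}) k : k.+1 < m ->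
  normal_at f k = switchable (ext f) k.
Proof.
move=> k1m; have km := ltnW k1m; apply/idP/idP=> [|H].
  move/forallP/(_ (Ordinal km))/forallP/(_ (Ordinal k1m)).
  by rewrite /= !eqxx /= /switchable !extE.
apply/forallP=> a; apply/forallP=> b; apply/implyP=> /andP[/eqP ak /eqP bk].
have {ak}-> : a = Ordinal km by apply/val_inj.
have {bk}-> : b = Ordinal k1m by apply/val_inj.
by move: H; rewrite /switchable !extE.
Qed.

Lemma ruled_atP e m n (f : {ffun 'I_m -> 'I_m}) (g : {ffun 'I_n -> 'I_n}) :
  n = step m e -> event_ok e m ->
  reflect (ruled e m n (ext f) (ext g)) (ruled_at e f g).
Proof.
case: e => k /= nE ok.
- rewrite pairedE; last by lia.
  by apply: (iffP andP) => -[/eqP ? /respectsP].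
- rewrite pairedE; last by lia.
  by apply: (iffP andP) => -[/eqP ? /respectsP].
rewrite !pairedE ?normal_atE ?nE; [|lia..].
apply: (iffP and3P) => [[/eqP a /eqP b /orP c]|[a b c]]; split=> //.
- by case: c => [/respectsP|/andP[/respectsP ? ?]]; [left|right].
- exact/eqP.
- exact/eqP.
by apply/orP; case: c => [?|[? ->]]; [left|right; rewrite andbT]; apply/respectsP.
Qed.

Definition event0 := LeftCusp 0.

Notation strands_at w i := (width 0 (take i w)).
Lemma width_take_nth m w i : i < size w ->
  width m (take i.+1 w) = step (width m (take i w)) (nth event0 w i).
Proof. by move=> iw; rewrite (take_nth event0 iw) -cats1 width_cat. Qed.

Lemma wf_nth m w i : wf m w -> i < size w ->
  event_ok (nth event0 w i) (width m (take i w)).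
Proof.
elim: w m i => //= e w IH m [|i] /andP[em wfw] //= iw.
exact: IH.
Qed.

Section Traces.
Variable F : front 0.

Let wfF : wf 0 F. Proof. by case: F => w /= /andP[]. Qed.
Lemma closed_width : strands_at F (size F) = 0.
Proof. by rewrite take_size; case: F => w /= /andP[_ /eqP]. Qed.

Lemma event_atE (i : 'I_(size F)) : event_at i = nth event0 F i.
Proof. by rewrite /event_at (tnth_nth event0). Qed.

Lemma ruling_of_trace (P : nat -> nat -> nat) :
  (forall i, i <= size F -> matching (strands_at F i) (P i)) ->
  (forall i, i < size F -> ruled (nth event0 F i) (strands_at F i) (strands_at F i.+1)
     (P i) (P i.+1)) ->
  exists rho : fiberwise F, is_ruling rho.
Proof.
move=> mP rP.
pose rho : fiberwise F :=
  [ffun i : 'I_(size F).+1 => [ffun j : 'I_(nstrands i) => insubd j (P i j)]].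
have rhoE (i : 'I_(size F).+1) (j : 'I_(nstrands i)) : rho i j = P i j :> nat.
  rewrite !ffunE val_insubd.
  by have [-> _ _] := mP i (ltn_ord i) j (ltn_ord j).
exists rho; apply/and3P; split.
- apply/forallP=> i; apply/forallP=> j.
  have [_ e1 e2] := mP i (ltn_ord i) j (ltn_ord j).
  by apply/andP; split; [apply/eqP/val_inj|apply/eqP=> /(congr1 val)]; rewrite /= ?rhoE.
- apply/respectsP => j j' _ j0; suff: j' < 0 by [].
  by move: j0; rewrite [X in _ < X -> _]/nstrands /= take0.
apply/forallP=> i.
have iw := ltn_ord i; have nE := width_take_nth 0 iw.
apply/ruled_atP; rewrite event_atE ?[in LHS]/nstrands //=; first exact: wf_nth.
apply: ruled_ext (rP i iw) => //; first exact: wf_nth.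
  by move=> j jm; rewrite (extE _ (jm : j < nstrands (before i))) rhoE.
by move=> j jm; rewrite (extE _ (jm : j < nstrands (after i))) rhoE.
Qed.

Definition trace (rho : fiberwise F) (i : nat) : nat -> nat :=
  if insub i is Some i' then ext (rho i') else id.

Lemma trace_ord rho (i : 'I_(size F).+1) : trace rho i = ext (rho i).
Proof. by rewrite /trace valK. Qed.

Variables (rho : fiberwise F) (rulF : is_ruling rho).

Lemma trace_matching i : i <= size F -> matching (strands_at F i) (trace rho i).
Proof.
rewrite -ltnS => iw j jm; have /and3P[/forallP/(_ (Ordinal iw))/forallP H _ _] := rulF.
rewrite -[i]/(val (Ordinal iw)) trace_ord.
rewrite (extE _ (jm : j < nstrands (Ordinal iw))) ext_ord.
have /andP[/eqP e1 e2] := H (Ordinal (jm : j < nstrands (Ordinal iw))).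
split; [exact: ltn_ord | by rewrite e1 |].
by move=> e; case/eqP: e2; apply/val_inj.
Qed.

Lemma trace_ruled i : i < size F ->
  ruled (nth event0 F i) (strands_at F i) (strands_at F i.+1)
    (trace rho i) (trace rho i.+1).
Proof.
move=> iw; have /and3P[_ _ /forallP/(_ (Ordinal iw))] := rulF.
rewrite event_atE => /ruled_atP.
rewrite -!trace_ord; apply; first exact: (width_take_nth 0 iw).
exact: wf_nth.
Qed.
End Traces.

(** * Moves on matchings *)
Definition unskip (k j : nat) : nat := if j < k then j else j.-2.

(* The conditionals are split from the inside out: linear arithmetic cannot read
   a test that itself contains a conditional. *)
Ltac by_cases := rewrite /swap /skip /unskip; 
  repeat match goal with |- context [if ?b then _ else _] =>
    lazymatch b with
    | context [if _ then _ else _] => fail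
    | _ => let H := fresh in destruct b eqn:H end
  end; lia.

(** [evolves m p w q] holds when some normal ruling over the piece of front [w],
    entered by [m] strands, restricts to [p] at its left end and to [q] at its
    right end. *)
Fixpoint evolves (m : nat) (p : nat -> nat) (w : seq event) (q : nat -> nat) : Prop :=
  if w is e :: w' then
    exists p', [/\ matching (step m e) p', ruled e m (step m e) p p'
                 & evolves (step m e) p' w' q]
  else forall j, j < m -> p j = q j.

Lemma trace_of_evolves m p w q : matching m p -> evolves m p w q ->
  exists P : nat -> nat -> nat,
    [/\ P 0 = p, forall i, i <= size w -> matching (width m (take i w)) (P i)
      & forall i, i < size w -> ruled (nth event0 w i)
          (width m (take i w)) (width m (take i.+1 w)) (P i) (P i.+1)].
Proof.
elim: w m p => [|e w IH] m p mp /=; first by exists (fun=> p); split=> // -[].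
case=> p' [mp' r /(IH _ _ mp')[P [P0 mP rP]]].
exists (fun i => if i is i'.+1 then P i' else p); split=> // -[|i] //=; last exact: rP.
  exact: mP.
by rewrite P0 take0.
Qed.

Lemma matching_eq m p j k : matching m p -> j < m -> k < m ->
  (p j == k) = (j == p k).
Proof.
by move=> mp /mp[_ pj _] /mp[_ pk _]; apply/eqP/eqP => [<-|->].
Qed.

Lemma evolves_extl m p p' w q : wf m w -> (forall j, j < m -> p j = p' j) ->
  evolves m p w q -> evolves m p' w q.
Proof.
case: w => [|e w] /=; first by move=> _ pp pq j jm; rewrite -pp ?pq.
move=> /andP[ok _] pp [r [mr rr e2]]; exists r; split=> //.
exact: ruled_ext rr.
Qed.

(** Rulings are built piecewise: one piece for each singularity of the knot and
    one for the pattern. *)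
Lemma evolves_cat m p w1 q w2 r : wf m (w1 ++ w2) ->
  evolves m p w1 q -> evolves (width m w1) q w2 r ->
  evolves m p (w1 ++ w2) r.
Proof.
elim: w1 m p => [|e w1 IH] m p /=.
  by move=> wf2 pq; apply: evolves_extl => // j jm; rewrite pq.
move=> /andP[_ wfw] [p' [mp' r' e1]] e2; exists p'; split=> //.
exact: IH.
Qed.

Lemma swapK k : involutive (swap k).
Proof. by move=> j; by_cases. Qed.

Lemma swap_lt k m j : k.+1 < m -> (swap k j < m) = (j < m).
Proof. by_cases. Qed.

(** A matching has exactly one continuation through a crossing that is not a
    switch, namely its conjugate by the transposition; similarly below for
    cusps. *)
Definition crossed k (p : nat -> nat) j := swap k (p (swap k j)).

Lemma matching_crossed k m p : k.+1 < m -> matching m p -> matching m (crossed k p).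
Proof.
move=> km mp j jm; rewrite /crossed swapK.
have [] := mp (swap k j); rewrite ?swap_lt // => -> -> pj; rewrite swapK; split=> //.
by move/(congr1 (swap k)); rewrite swapK.
Qed.

Lemma evolves_crossed k m p w q : k.+1 < m -> matching m p -> p k <> k.+1 ->
  evolves m (crossed k p) w q -> evolves m p (Crossing k :: w) q.
Proof.
move=> km mp pk e; exists (crossed k p); split=> //; first exact: matching_crossed.
have [a b c] := mp k (ltnW km); have [a' b' c'] := mp k.+1 km.
split=> //; last first.
  by left=> j j' _ _ /= /eqP ->; rewrite /crossed swapK.
have s1 : swap k k = k.+1 by by_cases.
rewrite /crossed s1 => /(congr1 (swap k)); rewrite swapK.
have -> : swap k k.+1 = k by by_cases.
by move=> e1; case: pk; rewrite -b' e1.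
Qed.

Lemma evolves_switched k m p w q : k.+1 < m -> matching m p -> p k <> k.+1 ->
  switchable p k ->
  evolves m p w q -> evolves m p (Crossing k :: w) q.
Proof.
move=> km mp pk s e; exists p; split=> //; split=> //; right; split=> //.
by move=> j j' _ _ /eqP ->.
Qed.

Lemma skipK k : cancel (skip k) (unskip k).
Proof. by move=> j; by_cases. Qed.

Lemma unskipK k j : j <> k -> j <> k.+1 -> skip k (unskip k j) = j.
Proof. by_cases. Qed.

Definition cupped k (p : nat -> nat) j :=
  if j == k then k.+1 else if j == k.+1 then k else skip k (p (unskip k j)).

Lemma matching_cupped k m p : k <= m -> matching m p -> matching m.+2 (cupped k p).
Proof.
move=> km mp j jm; rewrite /cupped.
case: (eqVneq j k) => [->|jk]; first by split; by_cases.
case: (eqVneq j k.+1) => [->|jk1]; first by split; by_cases.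
have [] := mp (unskip k j); first by_cases.
move=> a b c.
have -> : (skip k (p (unskip k j)) == k) = false by by_cases.
have -> : (skip k (p (unskip k j)) == k.+1) = false by by_cases.
rewrite skipK b unskipK; [|lia..].
split=> //; first by move: (p _) a => u a; by_cases.
by move=> e; apply: c; rewrite -[p _](skipK k) e.
Qed.

Lemma evolves_cupped k m p w q : k <= m -> matching m p ->
  evolves m.+2 (cupped k p) w q -> evolves m p (LeftCusp k :: w) q.
Proof.
move=> km mp e; exists (cupped k p); split=> //; first exact: matching_cupped.
split; first by rewrite /cupped eqxx.
move=> j j' jm _ /= /eqP ->; rewrite /cupped skipK.
by have [-> ->] : (skip k j == k) = false /\ (skip k j == k.+1) = false
  by split; by_cases.
Qed.

Definition capped k (p : nat -> nat) j := unskip k (p (skip k j)).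

(** [unskip] is undone by [skip] here because only the strands [k] and [k.+1],
    matched with each other, have no continuation. *)
Lemma capped_spec k m p : k.+1 < m -> matching m p -> p k = k.+1 ->
  forall j, j < m.-2 -> skip k (capped k p j) = p (skip k j).
Proof.
move=> km mp pk j jm; rewrite /capped.
have [a b c] := mp k (ltnW km).
have [] := mp (skip k j); first by_cases.
move=> a' b' c'.
rewrite unskipK // => e.
  by move: b'; rewrite e pk; by_cases.
by move: b'; rewrite e -pk b; by_cases.
Qed.

Lemma matching_capped k m p : k.+1 < m -> matching m p -> p k = k.+1 ->
  matching m.-2 (capped k p).
Proof.
move=> km mp pk j jm.
have e := capped_spec km mp pk jm.
have [] := mp (skip k j); first by_cases.
rewrite -e => a b c; split; first by move: a; by_cases.
  by rewrite {1}/capped b skipK.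
by move=> e'; case: c; rewrite e'.
Qed.

Lemma evolves_capped k m p w q : k.+1 < m -> matching m p -> p k = k.+1 ->
  evolves m.-2 (capped k p) w q -> evolves m p (RightCusp k :: w) q.
Proof.
move=> km mp pk e; exists (capped k p); split=> //; first exact: matching_capped.
split=> // j j' _ jm /= /eqP ->; apply/eqP.
by rewrite (capped_spec km mp pk).
Qed.

(** * The two-copy of a matching *)

(** The copies of strand [j] are [j.*2] and [j.*2.+1], the first one above the
    second.  If [j] is matched with [p j], copies of equal index are matched when
    [t j] is false, so that the two pairs interleave, and copies of different
    index when [t j] is true, so that the two pairs are nested. *)
Definition doubled (p : nat -> nat) (t : nat -> bool) (x : nat) : nat :=
  (p x./2).*2 + (odd x (+) t x./2).

Definition pair_invariant m (p : nat -> nat) (t : nat -> bool) : Prop :=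
  forall j, j < m -> t (p j) = t j.

Lemma matching_doubled m p t : matching m p -> pair_invariant m p t ->
  matching (m * 2) (doubled p t).
Proof.
move=> mp tp x xm; have xm2 : x./2 < m by lia.
have [a b c] := mp _ xm2; have d := tp _ xm2.
have h : (doubled p t x)./2 = p x./2 by rewrite /doubled; lia.
split.
- by rewrite /doubled; lia.
- by rewrite {1}/doubled h b d /doubled; lia.
by move=> e; apply: c; rewrite -h e.
Qed.

Lemma doubledE p t j (b : bool) : doubled p t (j.*2 + b) = (p j).*2 + (b (+) t j).
Proof.
rewrite /doubled; have -> : (j.*2 + b)./2 = j by lia.
by have -> : odd (j.*2 + b) = b by lia.
Qed.

Lemma swap_double a c (b : bool) :
  swap a.*2 (c.*2 + b) = c.*2 + (b (+) (c == a)).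
Proof. by case: (eqVneq c a) => [->|ca]; case: b => /=; by_cases. Qed.

(** A crossing between the two copies of strand [a] exchanges them, hence toggles
    the mark of its pair, unless it is a switch; and normality allows a switch
    exactly when the two pairs are nested.  Thus any change of mark is possible
    except from unmarked to unmarked. *)
Lemma evolves_satellite_crossing m p t u a :
  matching m p -> pair_invariant m p t -> pair_invariant m p u ->
  a < m -> (forall j, j < m -> j <> a -> j <> p a -> u j = t j) ->
  t a || u a -> forall w q, evolves (m * 2) (doubled p u) w q -> wf (m * 2) w ->
  evolves (m * 2) (doubled p t) (Crossing a.*2 :: w) q.
Proof.
move=> mp tp up am tu ta w q e wfw.
have md := matching_doubled mp tp.
have [a1 a2 a3] := mp a am.
have tpa := tp a am; have upa := up a am.
have d0 := doubledE p t a false; have d1 := doubledE p t a true.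
rewrite /= ?addn0 ?addn1 in d0 d1.
case: (boolP (t a && u a)) => [/andP[ta1 ua1]|tua].
  apply: evolves_switched => //; rewrite ?d0; [lia|lia| |].
    by rewrite /switchable /disjoint_itv /nested_itv d0 d1; lia.
  apply: evolves_extl e => // j jm; rewrite /doubled.
  case: (eqVneq j./2 a) => [->|n1]; first by rewrite ta1 ua1.
  case: (eqVneq j./2 (p a)) => [->|n2]; first by rewrite tpa upa ta1 ua1.
  by rewrite tu //; lia.
apply: evolves_crossed => //; rewrite ?d0; [lia|lia|].
have {tua ta} tua : u a = ~~ t a by case: (t a) (u a) ta tua => -[].
apply: evolves_extl e => // j jm.
have -> : j = j./2.*2 + odd j by lia.
have cm : j./2 < m by lia.
move: (j./2) (odd j) cm => c b cm.
rewrite /crossed swap_double !doubledE swap_double; congr (_ + nat_of_bool _).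
case: (eqVneq c a) => [->|ca].
  rewrite tua; have -> : (p a == a) = false by lia.
  by case: b; case: (t a).
case: (eqVneq c (p a)) => [->|cpa].
  by rewrite a2 eqxx upa tpa tua; case: b; case: (t a).
have -> : (p c == a) = false.
  by apply/eqP=> pca; have [_ e2 _] := mp c cm; case/eqP: cpa; rewrite -pca.
by rewrite !addbF tu //; apply/eqP.
Qed.

Lemma copies_crossing k : copies 2 (Crossing k) =
  [:: Crossing k.*2.+1; Crossing k.*2; Crossing k.+1.*2; Crossing k.*2.+1].
Proof. by rewrite /copies /= !mul2n !addn0 !addn1. Qed.

Lemma copies_left k : copies 2 (LeftCusp k) =
  [:: LeftCusp k.*2; LeftCusp k.+1.*2; Crossing k.*2.+1].
Proof. by rewrite /copies /copies_left_cusp /= !mul2n !addn0 !addn1 !addn2. Qed.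

Lemma copies_right k : copies 2 (RightCusp k) =
  [:: Crossing k.*2.+1; RightCusp k.+1.*2; RightCusp k.*2].
Proof.
by rewrite /copies /copies_left_cusp /mirror /= !mul2n ?addn0 ?addn1 ?addn2.
Qed.

(** A crossing of the knot becomes four crossings, at positions [k.*2.+1],
    [k.*2], [k.+1.*2], [k.*2.+1] in this order. *)
Section CrossingCopies.
Variables (m : nat) (p : nat -> nat) (t : nat -> bool) (k : nat).
Hypotheses (mp : matching m p) (tp : pair_invariant m p t).
Hypotheses (km : k.+1 < m) (pk : p k <> k.+1).

Let D := doubled p t.
Let mD : matching (m * 2) D. Proof. exact: matching_doubled. Qed.

(** The strands [k] and [k.+1] are not matched with each other, so the copies of
    their partners lie outside the block of four strands involved and are not
    moved by the four crossings. *)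
Lemma crossing_partners : p k.+1 <> k /\
  forall i, i < 4 -> (D (k.*2 + i))./2 = p (k + i./2) /\
    (D (k.*2 + i) < k.*2 \/ k.*2 + 3 < D (k.*2 + i)).
Proof.
have [a1 a2 a3] := mp (ltnW km); have [b1 b2 b3] := mp km.
have pk1 : p k.+1 <> k by move=> e; apply: pk; rewrite -b2 e.
split=> // i i4; rewrite /D /doubled.
have -> : (k.*2 + i)./2 = k + i./2 by lia.
split; first by lia.
have [->|->] : k + i./2 = k \/ k + i./2 = k.+1 by lia.
  by lia.
by lia.
Qed.

(** With no switch among the four crossings, the block of the two copies of [k]
    passes as a whole through that of [k.+1]. *)
Lemma evolves_copies_unswitched q u :
  (forall j, j < m -> q (swap k j) = swap k (p j)) ->
  (forall j, j < m -> u (swap k j) = t j) ->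
  evolves (m * 2) D (copies 2 (Crossing k)) (doubled q u).
Proof.
move=> qp ut; have [_ h] := crossing_partners.
have [[_ h0] [_ h1]] := (h 0 isT, h 1 isT).
rewrite addn0 in h0; rewrite addn1 in h1.
rewrite copies_crossing.
apply: evolves_crossed => //; [lia|lia|].
have m1 : matching (m * 2) (crossed k.*2.+1 D) by apply: matching_crossed; [lia|].
apply: evolves_crossed => //; [lia| |].
  rewrite /crossed; have -> : swap k.*2.+1 k.*2 = k.*2 by by_cases.
  by move: (D _) h0 => y; by_cases.
have m2 : matching (m * 2) (crossed k.*2 (crossed k.*2.+1 D)).
  by apply: matching_crossed => //; lia.
apply: evolves_crossed => //; [lia| |].
  rewrite /crossed; have -> : swap k.*2.+1 (swap k.*2 k.+1.*2) = k.*2.+1 by by_cases.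
  by move: (D _) h1 => y; by_cases.
have m3 : matching (m * 2) (crossed k.+1.*2 (crossed k.*2 (crossed k.*2.+1 D))).
  by apply: matching_crossed => //; lia.
apply: evolves_crossed => //; [lia| |].
  rewrite /crossed.
  have -> : swap k.*2.+1 (swap k.*2 (swap k.+1.*2 k.*2.+1)) = k.*2 by by_cases.
  by move: (D _) h0 => y; by_cases.
move=> x xm; rewrite /crossed /D.
have blocks c (b : bool) : swap k.*2.+1 (swap k.*2 (swap k.+1.*2
     (swap k.*2.+1 (c.*2 + b)))) = (swap k c).*2 + b.
  by case: b; by_cases.
have blocks' c (b : bool) : swap k.*2.+1 (swap k.+1.*2 (swap k.*2
     (swap k.*2.+1 (c.*2 + b)))) = (swap k c).*2 + b.
  by case: b; by_cases.
have -> : x = x./2.*2 + odd x by lia.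
have : x./2 < m by lia.
rewrite -(swap_lt _ km); move: (odd x) (x./2) => b c cm.
by rewrite blocks !doubledE blocks' -qp // -ut // swapK.
Qed.

Hypothesis sk : switchable p k.

(** At a switch of the knot, the first crossing is passed without switch; the
    second and third ones then each involve one copy of [k] and one of [k.+1],
    and inherit normality from the knot.  Switching both and passing the last
    crossing restores the doubled matching unchanged. *)
Lemma evolves_copies_kept q u : (forall j, j < m -> q j = p j) ->
  (forall j, j < m -> u j = t j) ->
  evolves (m * 2) D (copies 2 (Crossing k)) (doubled q u).
Proof.
move=> qp ut; have [pk1 h] := crossing_partners.
have [[f0 h0] [f1 h1]] := (h 0 isT, h 1 isT).
have [[f2 h2] [f3 h3]] := (h 2 isT, h 3 isT).
rewrite /= ?addn0 ?addn1 ?addn2 ?addn3 in f0 f1 f2 f3 h0 h1 h2 h3.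
have [a1 a2 a3] := mp (ltnW km); have [b1 b2 b3] := mp km.
have pp : p k <> p k.+1 by move=> e; have := a2; rewrite e b2; lia.
rewrite copies_crossing.
have C0 : crossed k.*2.+1 D k.*2 = D k.*2.
  rewrite /crossed; have -> : swap k.*2.+1 k.*2 = k.*2 by by_cases.
  by move: (D _) h0 => y; by_cases.
have C1 : crossed k.*2.+1 D k.*2.+1 = D k.*2.+2.
  rewrite /crossed; have -> : swap k.*2.+1 k.*2.+1 = k.*2.+2 by by_cases.
  by move: (D _) h2 => y; by_cases.
have C2 : crossed k.*2.+1 D k.*2.+2 = D k.*2.+1.
  rewrite /crossed; have -> : swap k.*2.+1 k.*2.+2 = k.*2.+1 by by_cases.
  by move: (D _) h1 => y; by_cases.
have C3 : crossed k.*2.+1 D k.*2.+3 = D k.*2.+3.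
  rewrite /crossed; have -> : swap k.*2.+1 k.*2.+3 = k.*2.+3 by by_cases.
  by move: (D _) h3 => y; by_cases.
have mC : matching (m * 2) (crossed k.*2.+1 D) by apply: matching_crossed; [lia|].
move: sk; rewrite /switchable /disjoint_itv /nested_itv => s.
apply: evolves_crossed => //; [lia|lia|].
apply: evolves_switched => //; [lia|rewrite C0;lia| |].
  by rewrite /switchable /disjoint_itv /nested_itv C0 C1; lia.
apply: evolves_switched => //; [lia|rewrite C2;lia| |].
  by rewrite /switchable /disjoint_itv /nested_itv C2 C3; lia.
apply: evolves_crossed => //; [lia|rewrite C1;lia|].
move=> x xm; rewrite /crossed !swapK /D /doubled qp ?ut //; lia.
Qed.

(** The other resolution of a switch of the knot: the first and last crossings
    are switches, which are normal whatever the marks, and in between each of the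
    pairs of [k] and of [k.+1] meets a crossing of its own two copies. *)
Lemma evolves_copies_flipped q u : pair_invariant m p u -> (forall j, j < m -> q j = p j) ->
  (forall j, j < m -> j <> k -> j <> p k -> j <> k.+1 -> j <> p k.+1 -> u j = t j) ->
  t k || u k -> t k.+1 || u k.+1 ->
  evolves (m * 2) D (copies 2 (Crossing k)) (doubled q u).
Proof.
move=> up qp ut tk tk1.
have [pk1 h] := crossing_partners.
have [a1 a2 a3] := mp (ltnW km); have [b1 b2 b3] := mp km.
have pp : p k <> p k.+1 by move=> e; have := a2; rewrite e b2; lia.
move: sk; rewrite /switchable /disjoint_itv /nested_itv => s.
have inner t' : pair_invariant m p t' -> forall w r, evolves (m * 2) (doubled p t') w r ->
    evolves (m * 2) (doubled p t') (Crossing k.*2.+1 :: w) r.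
  move=> tp' w r e.
  have d1 := doubledE p t' k true; have d2 := doubledE p t' k.+1 false.
  rewrite /= ?addn0 ?addn1 in d1 d2.
  apply: evolves_switched => //; rewrite ?d1; [lia|exact: matching_doubled|lia|].
  by rewrite /switchable /disjoint_itv /nested_itv d1 d2; lia.
rewrite copies_crossing; apply: (inner) => //.
(* The marks between the second and third crossings. *)
pose v j := if (j == k) || (j == p k) then u j else t j.
have vp : pair_invariant m p v.
  move=> j jm; rewrite /v; have [_ e2 _] := mp jm.
  have -> : (p j == k) || (p j == p k) = (j == k) || (j == p k).
    by rewrite !(matching_eq mp) ?(ltnW km) // a2 orbC.
  by case: ifP => _; rewrite ?up ?tp.
apply: (@evolves_satellite_crossing _ _ _ v) => //; try lia.
- by move=> j jm /eqP/negbTE j1 /eqP/negbTE j2; rewrite /v j1 j2.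
- by rewrite /v eqxx.
apply: (@evolves_satellite_crossing _ _ _ u) => //; try (rewrite /=; lia).
- move=> j jm j1 j2; rewrite /v; case: ifP => // jj.
  by apply: ut => // jj'; move: jj; rewrite jj' eqxx ?orbT.
- by rewrite /v ifF //; apply/eqP; lia.
2: by rewrite /=; lia.
apply: inner => // x xm.
by rewrite /doubled qp //; lia.
Qed.

End CrossingCopies.

(** * Cusps of the two-copy *)

(** Right of the two left cusps, the lower branch of the first copy crosses the
    upper branch of the second one; passing this crossing without switch matches
    copies of equal index, so that the new pair is unmarked. *)
Lemma evolves_copies_left m p t k q u : matching m p -> pair_invariant m p t -> k <= m ->
  matching m.+2 q -> pair_invariant m.+2 q u ->
  q k = k.+1 -> u k = false ->
  (forall j, j < m -> q (skip k j) = skip k (p j)) ->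
  (forall j, j < m -> u (skip k j) = t j) ->
  evolves (m * 2) (doubled p t) (copies 2 (LeftCusp k)) (doubled q u).
Proof.
move=> mp tp km mq uq qk uk qp ut; rewrite copies_left.
have mD := matching_doubled mp tp.
have m1 : matching (m * 2).+2 (cupped k.*2 (doubled p t)).
  by apply: matching_cupped => //; lia.
have m2 : matching (m * 2).+4 (cupped k.+1.*2 (cupped k.*2 (doubled p t))).
  by apply: matching_cupped => //; lia.
have kq : k < m.+2 by lia.
have [_ qk1 _] := mq k kq; rewrite qk in qk1.
have uk1 := uq k kq; rewrite qk uk in uk1.
apply: evolves_cupped => //; [lia|].
apply: evolves_cupped => //; [lia|].
apply: evolves_crossed => //; [lia| |].
  by rewrite /cupped; by_cases.
move=> x xm.
have -> : x = x./2.*2 + odd x by lia.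
have cm : x./2 < m.+2 by lia.
move: (x./2) (odd x) cm => {x xm} c b cm; rewrite doubledE.
have [->|ck] := eqVneq c k.
  by rewrite qk uk /crossed /cupped; case: b => /=; by_cases.
have [->|ck1] := eqVneq c k.+1.
  by rewrite qk1 uk1 /crossed /cupped; case: b => /=; by_cases.
have ce : c = skip k (unskip k c) by rewrite unskipK //; apply/eqP.
have c'm : unskip k c < m by move: cm ck ck1; by_cases.
rewrite ce; move: (unskip k c) c'm => {cm ck ck1 ce} {}c cm.
rewrite qp // ut // /crossed.
have -> : swap k.*2.+1 ((skip k c).*2 + b) = (skip k c).*2 + b.
  by case: b; by_cases.
rewrite /cupped.
have [-> ->] : ((skip k c).*2 + b == k.+1.*2) = false /\
    ((skip k c).*2 + b == k.+1.*2.+1) = false by case: b; split; by_cases.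
have [-> ->] : (unskip k.+1.*2 ((skip k c).*2 + b) == k.*2) = false /\
    (unskip k.+1.*2 ((skip k c).*2 + b) == k.*2.+1) = false.
  by case: b; split; by_cases.
have -> : unskip k.*2 (unskip k.+1.*2 ((skip k c).*2 + b)) = c.*2 + b.
  by case: b; by_cases.
rewrite doubledE; move: (p c) (b (+) t c) => d {}b.
by case: b; by_cases.
Qed.

Lemma evolves_copies_right m p t k q u : matching m p -> pair_invariant m p t -> k.+1 < m ->
  p k = k.+1 -> t k = false ->
  (forall j, j < m.-2 -> skip k (q j) = p (skip k j)) ->
  (forall j, j < m.-2 -> u j = t (skip k j)) ->
  evolves (m * 2) (doubled p t) (copies 2 (RightCusp k)) (doubled q u).
Proof.
move=> mp tp km pk tk qp ut; rewrite copies_right.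
have mD := matching_doubled mp tp.
have [_ pk1 _] := mp k (ltnW km); rewrite pk in pk1.
have tk1 := tp k (ltnW km); rewrite pk tk in tk1.
pose C := crossed k.*2.+1 (doubled p t).
have mC : matching (m * 2) C by apply: matching_crossed => //; lia.
have CE : C = crossed k.*2.+1 (doubled p t) by [].
have D0 := doubledE p t k false; have D1 := doubledE p t k true.
have D2 := doubledE p t k.+1 false; have D3 := doubledE p t k.+1 true.
rewrite /= ?addn0 ?addn1 pk ?pk1 ?tk ?tk1 /= in D0 D1 D2 D3.
have C0 : C k.*2 = k.*2.+1.
  rewrite CE /crossed; have -> : swap k.*2.+1 k.*2 = k.*2 by by_cases.
  by rewrite D0; by_cases.
have C2 : C k.*2.+2 = k.*2.+3.
  rewrite CE /crossed; have -> : swap k.*2.+1 k.*2.+2 = k.*2.+1 by by_cases.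
  by rewrite D1; by_cases.
have mC1 : matching (m * 2).-2 (capped k.+1.*2 C).
  by apply: matching_capped => //; lia.
have C1 : capped k.+1.*2 C k.*2 = k.*2.+1.
  rewrite /capped; have -> : skip k.+1.*2 k.*2 = k.*2 by by_cases.
  by rewrite C0; by_cases.
apply: evolves_crossed => //; [lia|lia|].
apply: evolves_capped => //; [lia|].
apply: evolves_capped => //; [lia|].
move=> x xm.
have -> : x = x./2.*2 + odd x by lia.
have cm : x./2 < m.-2 by lia.
move: (x./2) (odd x) cm => {x xm} c b cm; rewrite doubledE ut //.
rewrite /capped.
have -> : skip k.+1.*2 (skip k.*2 (c.*2 + b)) = (skip k c).*2 + b.
  by case: b; by_cases.
rewrite -/C CE /crossed.
have -> : swap k.*2.+1 ((skip k c).*2 + b) = (skip k c).*2 + b.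
  by case: b; by_cases.
rewrite doubledE -qp //; move: (q c) (b (+) _) => d {}b.
by case: b; by_cases.
Qed.

(** * Leafless subgraphs *)
Section LeaflessSubgraph.
Variables (V E : eqType) (src dst : E -> V).

Definition incident (f : E) (v : V) : bool := (src f == v) || (dst f == v).

(** No vertex outside [U] is incident to exactly one edge of [B]. *)
Definition leafless_off (U : pred V) (B : seq E) : Prop :=
  forall v f, ~~ U v -> f \in B -> incident f v ->
    exists2 f', f' \in B & (f' != f) && incident f' v.

(** This abstracts a path from [r] to [x]: all that is used of a path is where
    its ends and leaves are. *)
Definition stick (r x : V) (B : seq E) : Prop :=
  leafless_off (pred2 r x) B /\
  (x != r -> has (incident^~ r) B && has (incident^~ x) B).

(** [F] is the edge set of a tree with vertex set [X].  Only the consequences of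
    being a tree that matter are recorded: fewer edges than vertices, and a path
    from [r] to every vertex. *)
Definition tree (r : V) (X : seq V) (F : seq E) : Prop :=
  [/\ uniq X, r \in X, size F < size X,
      forall f, f \in F -> (src f \in X) && (dst f \in X)
    & forall x, x \in X -> exists2 B, {subset B <= F} & stick r x B].

Lemma stick_extend r x y f B F X : tree r X F -> {subset B <= F} -> stick r x B ->
  x \in X -> y \notin X ->
  incident f x -> incident f y -> (forall v, incident f v -> v = x \/ v = y) ->
  stick r y (f :: B).
Proof.
move=> [_ rX _ FX _] BF [lB hB] xX yX fx fy fv.
have By g : g \in B -> ~~ incident g y.
  move=> /BF/FX/andP[a b]; apply/negP=> /orP[] /eqP e; move: yX;
  by rewrite -e ?a ?b.
have fB : f \notin B by apply/negP => /By; rewrite fy.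
split=> [v g|yr].
  rewrite /= negb_or => /andP[vr vy].
  rewrite inE => /predU1P[->|gB] gv.
    have [vx|vy'] := fv v gv; last by rewrite vy' eqxx in vy.
    have xr : x != r by rewrite -vx.
    have /andP[_ /hasP[h hB' hx]] := hB xr; rewrite -vx in hx.
    by exists h; rewrite ?inE ?hB' ?orbT // hx andbT; apply: contraNneq fB => <-.
  have [vx|vx] := eqVneq v x.
    exists f; first by rewrite inE eqxx.
    by rewrite vx fx andbT; apply: contraNneq fB => ->.
  have [|h hB' hv] := lB v g _ gB gv; first by rewrite /= negb_or vr.
  by exists h => //; rewrite inE hB' orbT.
rewrite /= fy /= andbT.
have [->|xr] := eqVneq r x; first by rewrite fx.
by rewrite eq_sym in xr; have /andP[-> _] := hB xr; rewrite orbT.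
Qed.

Lemma tree_extend r X F f x y : tree r X F -> x \in X -> y \notin X ->
  incident f x -> incident f y -> (forall v, incident f v -> v = x \/ v = y) ->
  tree r (y :: X) (f :: F).
Proof.
move=> tXF xX yX fx fy fv; have [uX rX sF FX sX] := tXF.
split=> //=; [by rewrite yX|by rewrite inE rX orbT|move=> g|move=> z].
  rewrite !inE => /predU1P[->|/FX/andP[-> ->]]; last by rewrite !orbT.
  have [/fv e1 /fv e2] : incident f (src f) /\ incident f (dst f).
    by rewrite /incident !eqxx orbT.
  by case: e1 => ->; case: e2 => ->; rewrite ?eqxx ?xX ?orbT.
rewrite inE => /predU1P[->|/sX[B BF sB]]; last first.
  by exists B => // g /BF gF; rewrite inE gF orbT.
have [B BF sB] := sX x xX; exists (f :: B); last exact: (stick_extend tXF BF sB).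
by move=> g; rewrite !inE => /predU1P[->|/BF ->]; rewrite ?eqxx ?orbT.
Qed.

Variables (vs : seq V) (es : seq E) (r : V).
Hypothesis r_vs : r \in vs.
Hypothesis es_vs : forall f, f \in es -> (src f \in vs) && (dst f \in vs).
Hypothesis connected : forall Q : V -> Prop, Q r ->
  (forall f, f \in es -> Q (src f) <-> Q (dst f)) -> forall v, v \in vs -> Q v.

(** As long as some vertex is not reached, connectivity provides an edge with
    exactly one end in the tree, by which the tree can be extended. *)
Lemma spanning_tree : exists X F,
  [/\ tree r X F, {subset X <= vs}, {subset vs <= X} & {subset F <= es}].
Proof.
suff grow n X F : size vs < size X + n -> tree r X F -> {subset X <= vs} ->
    {subset F <= es} -> exists X F,
  [/\ tree r X F, {subset X <= vs}, {subset vs <= X} & {subset F <= es}].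
  apply: (grow (size vs) [:: r] [::]) => //.
    split=> // [|x]; first by rewrite inE.
    rewrite inE => /eqP ->; exists [::] => //; split=> //; by rewrite eqxx.
  by move=> x; rewrite inE => /eqP ->.
elim: n X F => [|n IH] X F szX tXF Xvs Fes.
  have [uX _ _ _ _] := tXF.
  by have := uniq_leq_size uX Xvs; lia.
have [/hasP[f fes]|/hasPn none] :=
  boolP (has (fun f => (src f \in X) != (dst f \in X)) es); last first.
  exists X, F; split=> //; apply: connected; first by case: tXF.
  by move=> f /none; rewrite negbK => /eqP ->.
have /andP[svs dvs] := es_vs fes.
have incE v : incident f v -> v = src f \/ v = dst f.
  by case/orP=> /eqP ->; [left|right].
have extend y x : y \in vs -> x \in X -> y \notin X ->
    incident f x -> incident f y -> (forall v, incident f v -> v = x \/ v = y) ->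
    exists X F, [/\ tree r X F, {subset X <= vs}, {subset vs <= X} & {subset F <= es}].
  move=> yvs xX yX fx fy fv; apply: (IH (y :: X) (f :: F)).
  - by rewrite /= addSnnS.
  - exact: tree_extend xX yX fx fy fv.
  - by move=> z; rewrite inE => /predU1P[->|/Xvs].
  - by move=> z; rewrite inE => /predU1P[->|/Fes].
have [sX|sX] := boolP (src f \in X); have [dX|dX] := boolP (dst f \in X) => // _.
  apply: (extend (dst f) (src f)); rewrite /incident ?eqxx ?orbT //.
apply: (extend (src f) (dst f)); rewrite /incident ?eqxx ?orbT //.
by move=> v /incE[]; [right|left].
Qed.

Hypothesis uniq_es : uniq es.
Hypothesis many_edges : size vs <= size es.

(** A connected graph with at least as many edges as vertices has an edge [f]
    outside a spanning tree.  The tree paths from [r] to both ends of [f],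
    together with [f], form the subgraph: a vertex other than [r] that is a leaf
    of one of the paths is an end of [f], and [f] is its second edge. *)
Theorem leafless_subgraph : exists B : seq E,
  [/\ {subset B <= es}, has (incident^~ r) B & leafless_off (pred1 r) B].
Proof.
have [X [F [[uX rX sF FX sX] Xvs vsX Fes]]] := spanning_tree.
have /allPn[f fes fF] : ~~ all [in F] es.
  apply/negP=> /allP esF; have := uniq_leq_size uniq_es esF.
  by have := uniq_leq_size uX Xvs; lia.
have /andP[/vsX svs /vsX dvs] := es_vs fes.
have [B1 B1F [l1 h1]] := sX _ svs; have [B2 B2F [l2 h2]] := sX _ dvs.
have fs : incident f (src f) by rewrite /incident eqxx.
have fd : incident f (dst f) by rewrite /incident eqxx orbT.
exists (f :: B1 ++ B2); split.
- move=> g; rewrite inE mem_cat => /predU1P[->//|/orP[/B1F|/B2F]]; exact: Fes.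
- rewrite /= has_cat.
  have [<-|sr] := eqVneq (src f) r; first by rewrite fs.
  by have /andP[-> _] := h1 sr; rewrite orbT.
have sub1 : {subset B1 <= f :: B1 ++ B2}.
  by move=> h hB; rewrite inE mem_cat hB orbT.
have sub2 : {subset B2 <= f :: B1 ++ B2}.
  by move=> h hB; rewrite inE mem_cat hB !orbT.
have stick_case x B : {subset B <= F} -> {subset B <= f :: B1 ++ B2} -> stick r x B ->
    incident f x -> forall v g, v != r -> g \in B -> incident g v ->
    exists2 f', f' \in f :: B1 ++ B2 & (f' != g) && incident f' v.
  move=> BF BB [lB _] fx v g vr gB gv.
  have [->|vx] := eqVneq v x.
    exists f; first by rewrite inE eqxx.
    by rewrite fx andbT; apply: contraNneq fF => ->; exact: BF.
  have [|h hB hv] := lB v g _ gB gv; first by rewrite /= negb_or vr.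
  by exists h => //; exact: BB.
move=> v g vr; rewrite inE mem_cat => /predU1P[->|/orP[gB|gB]] gv.
- have near x B : {subset B <= F} -> {subset B <= f :: B1 ++ B2} -> stick r x B ->
      x != r -> exists2 f', f' \in f :: B1 ++ B2 & (f' != f) && incident f' x.
    move=> BF BB [_ hB] /hB/andP[_ /hasP[h hB' hx]].
    exists h; first exact: BB.
    by rewrite hx andbT; apply: contraNneq fF => <-; exact: BF.
  case/orP: gv => /eqP e; rewrite -e in vr *.
    exact: (near _ B1).
  exact: (near _ B2).
- exact: (stick_case (src f) B1).
- exact: (stick_case (dst f) B2).
Qed.
End LeaflessSubgraph.

(** * The graph of a ruling *)

(** The vertex [inl (i, j)] is the pair over the [i]-th interval whose upper strand
    is [j], and [inr i] is the switch at the [i]-th event.  The edge [inl (i, j)]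
    leaves the pair [(i, j)] to the right, toward the next interval or toward a
    switch, and the edges [inr (i, _)] leave the switch at the [i]-th event to the
    right, toward the pairs of its two strands. *)
Notation vertex := ((nat * nat) + nat)%type.
Notation edge := ((nat * nat) + (nat * bool))%type.

Section RulingGraph.
Variables (w : seq event) (P : nat -> nat -> nat).
Notation wd i := (strands_at w i).
Notation N := (size w).

(** At a switch the matching does not change from one side to the other. *)
Definition switch_at (i : nat) : bool :=
  if nth event0 w i is Crossing _
  then all (fun j => P i j == P i.+1 j) (iota 0 (wd i)) else false.

Definition rep i j := minn j (P i j).

Lemma rep_or i k : rep i k = k \/ rep i k = P i k.
Proof. rewrite /rep; lia. Qed.

Hypothesis wfw : wf 0 w.
Hypothesis mP : forall i, i <= N -> matching (wd i) (P i).
Hypothesis rP : forall i, i < N ->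
  ruled (nth event0 w i) (wd i) (wd i.+1) (P i) (P i.+1).

(** Past a crossing that is not a switch the matching must change, so [switch_at]
    tells the two kinds of crossings apart: if the matching were both carried
    through the crossing and unchanged, [k] and [k.+1] would have the same
    partner. *)
Lemma ruled_spec i : i < N ->
  match nth event0 w i with
  | LeftCusp k => [/\ k <= wd i, wd i.+1 = (wd i).+2, P i.+1 k = k.+1
      & forall j, j < wd i -> P i.+1 (skip k j) = skip k (P i j)]
  | RightCusp k => [/\ k.+1 < wd i, wd i.+1 = (wd i).-2, P i k = k.+1
      & forall j, j < wd i.+1 -> P i (skip k j) = skip k (P i.+1 j)]
  | Crossing k => [/\ k.+1 < wd i, wd i.+1 = wd i, P i k <> k.+1
      & if switch_at i
        then switchable (P i) k /\ forall j, j < wd i -> P i.+1 j = P i j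
        else forall j, j < wd i -> P i.+1 (swap k j) = swap k (P i j)]
  end.
Proof.
move=> iN; have := rP iN; have := wf_nth wfw iN; have := width_take_nth 0 iN.
rewrite /switch_at; case: (nth event0 w i) => k /= -> ok.
- case=> qk c; split=> // j jm; apply/eqP/c => //=.
  by move: ok; by_cases.
- case=> pk c; split=> // j jm; apply/eqP/c => //=.
  by move: ok jm; by_cases.
case=> pk qk c; split=> //; case: allP => [same|diff].
  have same' j : j < wd i -> P i.+1 j = P i j.
    by move=> jm; apply/esym/eqP/same; rewrite mem_iota.
  split=> //; case: c => [c|[]//].
  have s1 : swap k k = k.+1 by by_cases.
  have s2 : swap k k.+1 = k by by_cases.
  have km := ltnW ok.
  have [a1 a2 a3] := mP (ltnW iN) km.
  have := c k k.+1 km ok; rewrite /= s1 eqxx => /(_ isT)/eqP.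
  rewrite same' // => e1.
  have pp : P i k <> k by [].
  have e : P i k.+1 = P i k by rewrite e1; move: pk a3; by_cases.
  by have := a2; rewrite -e; have [_ -> _] := mP (ltnW iN) ok; lia.
case: c => [c j jm|[c _]].
  by apply/eqP/c; rewrite /= ?swap_lt.
by case: diff => j; rewrite mem_iota /= => jm; apply: c.
Qed.

Hypothesis w_closed : wd N = 0.

Definition atom i j : vertex := inl (i, rep i j).

(** A pair ending at a right cusp has no edge to its right. *)
Definition closing (x : nat * nat) : bool :=
  if nth event0 w x.1 is RightCusp k then x.2 == k else false.

Definition src (f : edge) : vertex :=
  match f with inl x => inl x | inr (i, _) => inr i end.

Definition dst (f : edge) : vertex :=
  match f with
  | inl (i, j) =>
      match nth event0 w i with
      | LeftCusp k => inl (i.+1, skip k j)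
      | RightCusp k => inl (i.+1, unskip k j)
      | Crossing k =>
          if ~~ switch_at i then inl (i.+1, swap k j)
          else if j \in [:: rep i k; rep i k.+1] then inr i
          else inl (i.+1, j)
      end
  | inr (i, c) =>
      if nth event0 w i is Crossing k then inl (i.+1, rep i (k + c)) else inr i
  end.

(** The only edge that can arrive at the pair [(i.+1, j)] from the left. *)
Definition pred_edge i j : edge :=
  match nth event0 w i with
  | LeftCusp k => inl (i, unskip k j)
  | RightCusp k => inl (i, skip k j)
  | Crossing k =>
      if ~~ switch_at i then inl (i, swap k j)
      else if j == rep i k then inr (i, false)
      else if j == rep i k.+1 then inr (i, true) else inl (i, j)
  end.

Definition atoms : seq (nat * nat) :=
  [seq (i, j) | i <- iota 0 N.+1, j <- [seq j <- iota 0 (wd i) | j < P i j]].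
Definition switches := [seq i <- iota 0 N | switch_at i].
Definition vertices : seq vertex :=
  map inl atoms ++ map inr switches.
Definition edges : seq edge :=
  [seq inl x | x <- atoms & ~~ closing x] ++
  [seq inr x | x <- [seq (i, c) | i <- switches, c <- [:: false; true]]].

Lemma mem_atoms i j : ((i, j) \in atoms) = [&& i < N, j < wd i & j < P i j].
Proof.
apply/allpairsPdep/and3P => [[i' [j' [+ + [-> ->]]]]|[iN jw jp]].
  rewrite mem_iota mem_filter mem_iota /= add0n ltnS leq_eqVlt.
  case: eqP => [->|_ /=]; last by move=> -> /andP[-> ->].
  by rewrite w_closed andbF.
exists i, j; rewrite mem_iota mem_filter mem_iota jw jp; split=> //=.
by rewrite add0n ltnS ltnW.
Qed.

Lemma mem_switches i : (i \in switches) = (i < N) && switch_at i.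
Proof. by rewrite mem_filter mem_iota andbC. Qed.

Lemma mem_vertices v : (v \in vertices) =
  match v with inl x => x \in atoms | inr i => i \in switches end.
Proof.
rewrite mem_cat; case: v => x.
  by rewrite mem_map ?[_ \in map inr _](introF mapP) ?orbF // => [[]|? ? []].
by rewrite orbC mem_map ?[_ \in map inl _](introF mapP) ?orbF // => [[]|? ? []].
Qed.

Lemma mem_edges f : (f \in edges) =
  match f with
  | inl x => (x \in atoms) && ~~ closing x
  | inr (i, _) => i \in switches
  end.
Proof.
rewrite mem_cat; case: f => [x|[i c]].
  rewrite mem_map ?[_ \in map inr _](introF mapP) ?orbF => [|[]//|? ? []//].
  by rewrite mem_filter andbC.
rewrite orbC mem_map ?[_ \in map inl _](introF mapP) ?orbF => [|[]//|? ? []//].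
apply/allpairsP/idP => [[[i' c'] [/= + _ [-> _]]]//|iS].
by exists (i, c); split=> //=; case: c.
Qed.

Lemma uniq_atoms : uniq atoms.
Proof.
apply: allpairs_uniq_dep; first exact: iota_uniq.
  by move=> i _; rewrite filter_uniq ?iota_uniq.
by move=> [? ?] [? ?] _ _ /= [<- <-].
Qed.

Lemma uniq_edges : uniq edges.
Proof.
rewrite cat_uniq !map_inj_uniq; [|by move=> ? ? []..].
rewrite filter_uniq ?uniq_atoms // allpairs_uniq ?filter_uniq ?iota_uniq //=.
  by rewrite andbT; apply/hasPn => _ /mapP[x _ ->]; apply/mapP => -[].
by move=> [? ?] [? ?].
Qed.

Hypothesis many_switches : count is_right_cusp w <= count switch_at (iota 0 N).

(** Every pair has one edge to its right, except those closed by a right cusp,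
    and every switch has two.  So the number of edges minus the number of vertices
    is the number of switches minus the number of right cusps. *)
Lemma size_vertices_edges : size vertices <= size edges.
Proof.
rewrite !size_cat !size_map size_allpairs /= muln2 -addnn addnA leq_add2r.
rewrite -(count_predC closing atoms) addnC size_filter leq_add2l.
rewrite [size switches]size_filter; apply: leq_trans many_switches.
have -> : count is_right_cusp w = size [seq i <- iota 0 N | is_right_cusp (nth event0 w i)].
  by rewrite size_filter -[in LHS](mkseq_nth event0 w) count_map.
rewrite -size_filter -(size_map fst); apply: uniq_leq_size.
  rewrite map_inj_in_uniq ?filter_uniq ?uniq_atoms // => -[i j] [i' j'].
  rewrite !mem_filter /closing /= => /andP[+ _] /andP[+ _] e; rewrite -e.
  by case: (nth event0 w i) => // k /eqP-> /eqP->.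
move=> i /mapP[[i' j] + ->]; rewrite !mem_filter mem_atoms /closing /=.
by case/andP=> + /and3P[iN _ _]; case: (nth event0 w i') => //; rewrite mem_iota.
Qed.

Lemma mem_atom i j : i <= N -> j < wd i -> (i, rep i j) \in atoms.
Proof.
move=> iN jw; have [a b c] := mP iN jw; rewrite mem_atoms.
have -> /= : i < N.
  by move: iN; rewrite leq_eqVlt => /predU1P[e|//]; move: jw; rewrite e w_closed.
by rewrite /rep; case: (ltngtP j (P i j)) => [h|h|/esym//]; apply/andP; split=> //; rewrite ?b.
Qed.

Lemma rep_partner i j : i <= N -> j < wd i -> rep i (P i j) = rep i j.
Proof. by move=> iN /(mP iN)[_ b _]; rewrite /rep b minnC. Qed.

Lemma rep_top i j : (i, j) \in atoms -> rep i j = j.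
Proof. by rewrite mem_atoms /rep => /and3P[_ _ h]; apply/minn_idPl/ltnW. Qed.

Lemma edge_inl i j : (inl (i, j) : edge) \in edges ->
  [/\ i < N, j < wd i, j < P i j, ~~ closing (i, j) & rep i j = j].
Proof.
rewrite mem_edges => /andP[ja nc]; have := ja; rewrite mem_atoms => /and3P[? ? ?].
by split=> //; exact: rep_top.
Qed.

Lemma edge_of_atom i j : i < N -> j < wd i ->
  (if nth event0 w i is RightCusp k then (j != k) && (j != k.+1) else true) ->
  (inl (i, rep i j) : edge) \in edges.
Proof.
move=> iN jw h; rewrite mem_edges mem_atom ?(ltnW iN) //=.
have := ruled_spec iN; move: h; rewrite /closing /=.
case: (nth event0 w i) => // k' /andP[jk jk1] [km _ pk _].
have [_ pk1 _] := mP (ltnW iN) (ltnW km); rewrite pk in pk1.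
apply: contra jk1 => /eqP rk.
have [e|e] := rep_or i j; rewrite e in rk; first by rewrite rk eqxx in jk.
by have [_ <- _] := mP (ltnW iN) jw; rewrite rk pk.
Qed.

Lemma edge_of_switch i c : i < N -> switch_at i ->
  (inr (i, c) : edge) \in edges.
Proof. by move=> iN sw; rewrite mem_edges mem_switches iN. Qed.

Lemma dst_left_cusp i k j : i < N -> nth event0 w i = LeftCusp k -> j < wd i ->
  dst (inl (i, rep i j)) = atom i.+1 (skip k j).
Proof.
move=> iN ei jw; have := ruled_spec iN; rewrite ei => -[_ _ _ /(_ j jw) pj].
by rewrite /dst ei /atom /rep pj; congr (inl (_, _)); by_cases.
Qed.

Lemma dst_right_cusp i k j : i < N -> nth event0 w i = RightCusp k -> j < wd i.+1 ->
  dst (inl (i, rep i (skip k j))) = atom i.+1 j.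
Proof.
move=> iN ei jw; have := ruled_spec iN; rewrite ei => -[_ _ _ /(_ j jw) pj].
by rewrite /dst ei /atom /rep pj; congr (inl (_, _)); by_cases.
Qed.

Lemma dst_crossing i k j : i < N -> nth event0 w i = Crossing k -> ~~ switch_at i ->
  j < wd i -> dst (inl (i, rep i j)) = atom i.+1 (swap k j).
Proof.
move=> iN ei sw jw; have := ruled_spec iN; rewrite ei (negbTE sw).
move=> [km _ pk /(_ j jw) pj].
have [_ ppj jp] := mP (ltnW iN) jw.
have [_ ppk _] := mP (ltnW iN) km.
have n1 : ~ (j = k /\ P i j = k.+1) by case=> -> .
have n2 : ~ (j = k.+1 /\ P i j = k) by case=> e e'; apply: pk; move: ppj; rewrite e' e.
rewrite /dst ei sw /atom /rep pj; congr (inl (_, _)).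
by move: (P i j) jp n1 n2 => q; by_cases.
Qed.

Section SwitchEdges.
Variables (i k : nat).
Hypotheses (iN : i < N) (ei : nth event0 w i = Crossing k) (sw : switch_at i).

Let spec : [/\ k.+1 < wd i, wd i.+1 = wd i, P i k <> k.+1,
  switchable (P i) k & forall j, j < wd i -> P i.+1 j = P i j].
Proof. by have := ruled_spec iN; rewrite ei sw => -[? ? ? []]. Qed.

Lemma rep_switch j : j < wd i -> rep i.+1 j = rep i j.
Proof. by case: spec => _ _ _ _ s /s e; rewrite /rep e. Qed.

Lemma dst_switch_away j : j < wd i ->
  rep i j <> rep i k -> rep i j <> rep i k.+1 ->
  dst (inl (i, rep i j)) = atom i.+1 j.
Proof.
move=> jw /eqP/negbTE n1 /eqP/negbTE n2.
by rewrite /dst ei sw !inE n1 n2 /= /atom rep_switch.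
Qed.

Lemma dst_into_switch (c : bool) : dst (inl (i, rep i (k + c))) = inr i.
Proof.
by rewrite /dst ei sw !inE; case: c; rewrite ?addn0 ?addn1 eqxx ?orbT.
Qed.

Lemma dst_from_switch (c : bool) : dst (inr (i, c)) = atom i.+1 (k + c).
Proof.
have [km _ _ _ _] := spec.
by rewrite /dst ei /atom rep_switch //; case: c; lia.
Qed.

Lemma rep_crossing_neq : rep i k <> rep i k.+1.
Proof.
have [km _ pk _ _] := spec.
have [_ a _] := mP (ltnW iN) km; have [_ b _] := mP (ltnW iN) (ltnW km).
have pk1 : P i k.+1 <> k by move=> e; apply: pk; rewrite e in a.
have pp : P i k <> P i k.+1 by move=> e; rewrite e a in b; lia.
rewrite /rep; lia.
Qed.
End SwitchEdges.

Lemma dst_inr i c : (inr (i, c) : edge) \in edges ->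
  exists k, [/\ i < N, nth event0 w i = Crossing k & switch_at i].
Proof.
rewrite mem_edges mem_switches => /andP[iN sw]; move: (sw); rewrite {1}/switch_at.
by case: (nth event0 w i) => // k _; exists k.
Qed.

Lemma atom_vertex i j : i <= N -> j < wd i -> atom i j \in vertices.
Proof. by rewrite mem_vertices; exact: mem_atom. Qed.

Lemma edges_vertices f : f \in edges -> (src f \in vertices) && (dst f \in vertices).
Proof.
case: f => [[i j]|[i c]] fe; last first.
  have [k [iN ei sw]] := dst_inr fe.
  have := ruled_spec iN; rewrite ei sw => -[km wS _ _].
  rewrite (dst_from_switch iN ei sw) mem_vertices /= mem_switches iN sw /=.
  by apply: atom_vertex => //; rewrite wS; case: c {fe}; lia.
have [iN jw jp nc rj] := edge_inl fe; have [w1 w2] := (ltnW iN, iN).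
apply/andP; split; first by rewrite mem_vertices /= mem_atoms iN jw jp.
rewrite -rj.
have spec := ruled_spec iN.
case ei : (nth event0 w i) spec => [k|k|k].
- case=> ki wS _ _; rewrite (dst_left_cusp iN ei jw) atom_vertex //.
  by rewrite wS; move: jw; by_cases.
- case=> ki wS pk _.
  have jk : j <> k by move=> jk; move: nc; rewrite /closing /= ei jk eqxx.
  have jk1 : j <> k.+1.
    by move=> e; have [_ b _] := mP w1 (ltnW ki); rewrite pk in b; rewrite e b in jp; lia.
  have j'w : unskip k j < wd i.+1 by rewrite wS; move: jw; by_cases.
  rewrite -{1}(unskipK jk jk1) (dst_right_cusp iN ei j'w) atom_vertex //.
case: ifP => [sw|/negbT nsw] [ki wS pk _]; last first.
  by rewrite (dst_crossing iN ei nsw jw) atom_vertex // wS swap_lt.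
have [rk|rk] := eqVneq (rep i j) (rep i k).
  have := dst_into_switch ei sw false; rewrite addn0 -rk => ->.
  by rewrite mem_vertices mem_switches iN.
have [rk1|rk1] := eqVneq (rep i j) (rep i k.+1).
  have := dst_into_switch ei sw true; rewrite addn1 -rk1 => ->.
  by rewrite mem_vertices mem_switches iN.
rewrite (dst_switch_away iN ei sw jw); [|exact/eqP..].
by rewrite atom_vertex // wS.
Qed.

Lemma dst_inj_atom i j f : f \in edges -> dst f = atom i j ->
  exists2 i', i = i'.+1 & f = pred_edge i' (rep i j).
Proof.
case: f => [[i' j']|[i' c]] fe; last first.
  have [k [iN ei sw]] := dst_inr fe.
  have spec := ruled_spec iN; rewrite ei sw in spec; have [km wS _ _] := spec.
  rewrite /dst ei => -[<- <-]; exists i' => //; rewrite /pred_edge ei sw /=.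
  case: c {fe}; rewrite ?addn0 ?addn1 eqxx //.
  by have /eqP/negbTE := rep_crossing_neq iN ei sw; rewrite eq_sym => ->.
have [iN jw jp nc rj] := edge_inl fe.
have := ruled_spec iN; rewrite /dst /pred_edge.
case ei : (nth event0 w i') => [k|k|k].
- by move=> _ [<- <-]; exists i' => //; rewrite ei skipK.
- case=> ki wS pk _ [<- <-].
  have jk : j' <> k by move=> jk; move: nc; rewrite /closing /= ei jk eqxx.
  have jk1 : j' <> k.+1.
    move=> e; have [_ b _] := mP (ltnW iN) (ltnW ki); rewrite pk in b.
    by rewrite e b in jp; lia.
  by exists i' => //; rewrite ei unskipK.
case: ifP => //= sw _.
  rewrite !inE; case: ifP => // /norP[n1 n2] [<- <-].
  by exists i' => //; rewrite ei sw (negbTE n1) (negbTE n2).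
by case=> <- <-; exists i' => //; rewrite ei sw swapK.
Qed.

Lemma dst_atom_inj i j f g : f \in edges -> g \in edges -> dst f = atom i j ->
  dst g = atom i j -> f = g.
Proof.
by move=> fe ge /(dst_inj_atom fe)[i' -> ->] /(dst_inj_atom ge)[i'' [<-] ->].
Qed.

Hypothesis connP : forall Q : nat -> nat -> Prop,
  (forall i j, i <= N -> j < wd i -> Q i (P i j) <-> Q i j) ->
  (forall i j j', i < N -> j < wd i -> j' < wd i.+1 ->
     through (nth event0 w i) j j' -> Q i j <-> Q i.+1 j') ->
  forall i j i' j', i <= N -> j < wd i -> i' <= N -> j' < wd i' ->
  Q i j -> Q i' j'.

Variables (i0 a : nat).
Hypotheses (i0N : i0 <= N) (aw : a < wd i0).

(** Following the knot from a strand to an adjacent one, one goes from a pair to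
    itself, along an edge, or across a switch. *)
Lemma graph_connected (Q : vertex -> Prop) : Q (atom i0 a) ->
  (forall f, f \in edges -> Q (src f) <-> Q (dst f)) ->
  forall v, v \in vertices -> Q v.
Proof.
move=> Qr Qe.
have Qsw i k : i < N -> nth event0 w i = Crossing k -> switch_at i -> forall j, j < wd i ->
    rep i j = rep i k \/ rep i j = rep i k.+1 ->
    (Q (atom i j) <-> Q (inr i)) /\ (Q (atom i.+1 j) <-> Q (inr i)).
  move=> iN ei sw j jw rj.
  have spec := ruled_spec iN; rewrite ei sw in spec; have [km wS _ _] := spec.
  have rjc : exists c : bool, rep i j = rep i (k + c).
    by case: rj => ->; [exists false; rewrite addn0|exists true; rewrite addn1].
  case: rjc => c rc; have kc : k + c < wd i by case: c {rc}; lia.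
  have e1 : (inl (i, rep i (k + c)) : edge) \in edges.
    by apply: edge_of_atom => //; rewrite ei.
  have := Qe _ (edge_of_switch c iN sw); have := Qe _ e1.
  rewrite (dst_from_switch iN ei sw) (dst_into_switch ei sw).
  by rewrite /atom /= !(rep_switch iN ei sw) // rc => -> [h1 h2]; split; split.
have conn : forall i j, i <= N -> j < wd i -> Q (atom i j).
  move=> i j iN jw.
  apply: (connP (Q := fun i j => Q (atom i j)) _ _ i0N aw iN jw Qr).
    by move=> {}i {}j {}iN {}jw; rewrite /atom rep_partner.
  move=> {j jw} {}i j j' {}iN jw j'w.
  have spec := ruled_spec iN.
  case ei : (nth event0 w i) spec => [k|k|k] /=.
  - move=> _ /eqP->; rewrite -(dst_left_cusp iN ei jw); apply: (Qe (inl _)).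
    by apply: edge_of_atom => //; rewrite ei.
  - move=> _ /eqP jE; rewrite jE -(dst_right_cusp iN ei j'w); apply: (Qe (inl _)).
    apply: edge_of_atom => //; first by rewrite -jE.
    by rewrite ei; apply/andP; split; apply/eqP; by_cases.
  case: ifP => [sw|/negbT nsw] [ki wS pk _] /eqP->; last first.
    rewrite -(dst_crossing iN ei nsw jw); apply: (Qe (inl _)).
    by apply: edge_of_atom => //; rewrite ei.
  have s j1 j2 : j1 < wd i -> j2 < wd i ->
      rep i j1 = rep i k \/ rep i j1 = rep i k.+1 ->
      rep i j2 = rep i k \/ rep i j2 = rep i k.+1 -> Q (atom i j1) <-> Q (atom i.+1 j2).
    move=> j1w j2w /(Qsw _ _ iN ei sw _ j1w)[-> _].
    by move=> /(Qsw _ _ iN ei sw _ j2w)[_ ->].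
  have [->|jk] := eqVneq j k.
    by have -> : swap k k = k.+1; [by_cases|apply: s => //; [lia|left|right]].
  have [->|jk1] := eqVneq j k.+1.
    by have -> : swap k k.+1 = k; [by_cases|apply: s => //; [lia|right|left]].
  have -> : swap k j = j by move: jk jk1; by_cases.
  have [rk|rk] := eqVneq (rep i j) (rep i k); first by apply: s => //; left.
  have [rk1|rk1] := eqVneq (rep i j) (rep i k.+1); first by apply: s => //; right.
  rewrite -(dst_switch_away iN ei sw jw); [|exact/eqP..]; apply: (Qe (inl _)).
  by apply: edge_of_atom => //; rewrite ei.
case=> [[i j]|i]; rewrite mem_vertices => vv.
  have := vv; rewrite mem_atoms => /and3P[iN jw _].
  by have := conn i j (ltnW iN) jw; rewrite /atom rep_top.
move: vv; rewrite mem_switches => /andP[iN sw].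
have [k [_ ei _]] := dst_inr (edge_of_switch true iN sw).
have spec := ruled_spec iN; rewrite ei sw in spec; have [km wS _ _] := spec.
by have [<- _] := Qsw i k iN ei sw k (ltnW km) (or_introl erefl); apply: conn; lia.
Qed.

(** How marks may change past the [i]-th event so that the doubled matching can be
    continued over the two-copy of that event.  At a switch, the last clause says
    that the number of marks among the four incident pairs is not one. *)
Definition transition i (tR uL : nat -> bool) : Prop :=
  match nth event0 w i with
  | LeftCusp k => uL k = false /\ forall j, j < wd i -> uL (skip k j) = tR j
  | RightCusp k => tR k = false /\ forall j, j < wd i.+1 -> uL j = tR (skip k j)
  | Crossing k =>
      if switch_at i then
        (forall j, j < wd i -> j <> k -> j <> P i k -> j <> k.+1 -> j <> P i k.+1 ->
           uL j = tR j) /\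
        ((uL k = tR k /\ uL k.+1 = tR k.+1) \/
         ((tR k || uL k) /\ (tR k.+1 || uL k.+1)))
      else forall j, j < wd i -> uL (swap k j) = tR j
  end.

(** A pair is marked on its left, or on its right, when its edge on that side
    belongs to a subgraph whose only possible leaf is the pair of the base point.
    Any other pair has one edge on each side at most, so both of its marks agree;
    at cusps one of the edges is missing, so the mark vanishes. *)
Lemma marks_exist : exists tL tR : nat -> nat -> bool,
  [/\ forall i, i <= N ->
        pair_invariant (wd i) (P i) (tL i) /\ pair_invariant (wd i) (P i) (tR i),
      forall i j, i <= N -> j < wd i -> (i, rep i j) != (i0, rep i0 a) ->
        tL i j = tR i j,
      tL i0 a || tR i0 a
    & forall i, i < N -> transition i (tR i) (tL i.+1)].
Proof.
have r_vs : atom i0 a \in vertices := atom_vertex i0N aw.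
have [B [Bes /hasP[fr frB fri] lB]] := leafless_subgraph r_vs edges_vertices
  graph_connected uniq_edges size_vertices_edges.
exists (fun i j => has (fun f => dst f == atom i j) B).
exists (fun i j => inl (i, rep i j) \in B).
have srcE f i j : f \in edges -> src f = atom i j -> f = inl (i, rep i j).
  by case: f => [[i' j']|[i' c]] //= _ [-> ->].
have tLE i j f : f \in edges -> dst f = atom i j ->
    has (fun f => dst f == atom i j) B = (f \in B).
  move=> fe fd; apply/hasP/idP => [[g gB /eqP gd]|fB].
    by rewrite (dst_atom_inj fe (Bes _ gB) fd gd).
  by exists f => //; rewrite fd.
split.
- move=> i iN; split=> j jw; last by rewrite rep_partner.
  by apply: eq_has => f; rewrite /atom rep_partner.
- move=> i j iN jw nr; apply/hasP/idP => [[f fB /eqP fd]|fB].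
    have [||f' f'B /andP[ff' /orP[/eqP f's|/eqP f'd]]] := lB (atom i j) f _ fB.
    + by apply: contraNneq nr => -[-> ->].
    + by rewrite /incident fd eqxx orbT.
    + by rewrite -(srcE _ _ _ (Bes _ f'B) f's).
    by case/eqP: ff'; apply: dst_atom_inj f'd fd; exact: Bes.
  have [||f' f'B /andP[ff' /orP[/eqP f's|/eqP f'd]]] := lB (atom i j) _ _ fB.
  + by apply: contraNneq nr => -[-> ->].
  + by rewrite /incident eqxx.
  + by rewrite (srcE _ _ _ (Bes _ f'B) f's) eqxx in ff'.
  by exists f' => //; apply/eqP.
- case/orP: fri => /eqP e.
    by rewrite -(srcE _ _ _ (Bes _ frB) e) frB orbT.
  by apply/orP; left; apply/hasP; exists fr => //; apply/eqP.
move=> i iN; have spec := ruled_spec iN; rewrite /transition.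
case ei : (nth event0 w i) spec => [k|k|k].
- move=> [ki wS qk _]; split.
    apply/hasPn => f fB; apply/eqP => fd.
    have fe := Bes _ fB; have [i' [ii'] fE] := dst_inj_atom fe fd.
    have rk : rep i.+1 k = k by rewrite /rep qk; lia.
    rewrite fE /pred_edge -ii' ei rk in fd; move: fd.
    by rewrite /dst ei /atom rk => -[]; by_cases.
  move=> j jw; apply: tLE; last exact: dst_left_cusp.
  by apply: edge_of_atom => //; rewrite ei.
- move=> [ki wS pk _]; split.
    apply/negbTE/negP => /Bes; rewrite mem_edges /closing /= ei => /andP[_ /eqP[]].
    by rewrite /rep pk; lia.
  move=> j jw; apply: tLE; last exact: dst_right_cusp.
  apply: edge_of_atom => //; first by move: jw; rewrite wS; by_cases.
  by rewrite ei; apply/andP; split; apply/eqP; by_cases.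
case: ifP => [sw|/negbT nsw] [ki wS pk _]; last first.
  move=> j jw; apply: tLE; last exact: dst_crossing.
  by apply: edge_of_atom => //; rewrite ei.
split.
  move=> j jw jk jpk jk1 jpk1; apply: tLE.
    by apply: edge_of_atom => //; rewrite ei.
  have [_ b _] := mP (ltnW iN) jw.
  have away l : l < wd i -> j <> l -> j <> P i l -> rep i j <> rep i l.
    move=> lw jl jpl; have [_ b' _] := mP (ltnW iN) lw.
    have [|] := rep_or i j; have [|] := rep_or i l => -> -> // e.
      by apply: jpl; rewrite -e b.
    by apply: jl; rewrite -b e b'.
  by apply: (dst_switch_away iN ei sw jw); apply: away => //; lia.
(* The four edges at the switch; if the subgraph contains one of them, it
   contains another one. *)
pose e1 : edge := inl (i, rep i k).
pose e2 : edge := inl (i, rep i k.+1).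
pose e3 : edge := inr (i, false).
pose e4 : edge := inr (i, true).
have := dst_into_switch ei sw false; have := dst_into_switch ei sw true.
have := dst_from_switch iN ei sw false; have := dst_from_switch iN ei sw true.
rewrite addn0 addn1 => d4 d3 d2 d1.
rewrite (tLE _ _ e3 _ d3) ?(tLE _ _ e4 _ d4) ?edge_of_switch // -/e1 -/e2.
have incE f : f \in B -> incident src dst f (inr i) -> f \in [:: e1; e2; e3; e4].
  move=> fB; case: f fB => [[i' j]|[i' c]] /Bes fe.
    rewrite /incident /= => /eqP.
    have [iN' jw _ _ rj] := edge_inl fe.
    case ei' : (nth event0 w i') => //; case: ifP => // _; case: ifP => // + [ii'].
    move: ei'; rewrite ii' ei => -[<-]; rewrite !inE => /orP[]/eqP->.
      by rewrite eqxx.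
    by rewrite eqxx orbT.
  have [k' [iN' ei' _]] := dst_inr fe.
  rewrite /incident /= ei' orbF => /eqP[->].
  by case: c {fe}; rewrite !inE eqxx ?orbT.
have other f : f \in B -> incident src dst f (inr i) ->
    exists2 f', f' \in B & (f' != f) && (f' \in [:: e1; e2; e3; e4]).
  move=> fB fi; have [//|f' f'B /andP[ff' /incE]] := lB (inr i) f _ fB fi.
  by move=> h; exists f' => //; rewrite ff' h.
have i1 : incident src dst e1 (inr i) by rewrite /incident d1 eqxx orbT.
have i2 : incident src dst e2 (inr i) by rewrite /incident d2 eqxx orbT.
have i3 : incident src dst e3 (inr i) by rewrite /incident eqxx.
have i4 : incident src dst e4 (inr i) by rewrite /incident eqxx.
have o1 : e1 \in B -> [|| e2 \in B, e3 \in B | e4 \in B].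
  move=> /other/(_ i1)[f fB]; rewrite !inE => /andP[/negbTE-> /=].
  by case/or3P=> /eqP <-; rewrite fB ?orbT.
have o2 : e2 \in B -> [|| e1 \in B, e3 \in B | e4 \in B].
  move=> /other/(_ i2)[f fB]; rewrite !inE => /andP[/negbTE-> /=].
  by case/or3P=> /eqP <-; rewrite fB ?orbT.
have o3 : e3 \in B -> [|| e1 \in B, e2 \in B | e4 \in B].
  move=> /other/(_ i3)[f fB]; rewrite !inE => /andP[/negbTE-> /=].
  by case/or3P=> /eqP <-; rewrite fB ?orbT.
have o4 : e4 \in B -> [|| e1 \in B, e2 \in B | e3 \in B].
  move=> /other/(_ i4)[f fB]; rewrite !inE => /andP[/negbTE-> /=].
  by rewrite orbF; case/or3P=> /eqP <-; rewrite fB ?orbT.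
move: o1 o2 o3 o4.
by case: (e1 \in B); case: (e2 \in B); case: (e3 \in B); case: (e4 \in B) => /= o1 o2 o3 o4;
  first [by left | by right | by have := o1 isT | by have := o2 isT
        | by have := o3 isT | by have := o4 isT].
Qed.
End RulingGraph.

(** * The ruling of the satellite *)
Lemma evolves_ncopy m w (D : nat -> nat -> nat) : wf m w ->
  (forall l, l < size w -> evolves (width m (take l w) * 2) (D l)
     (copies 2 (nth event0 w l)) (D l.+1)) ->
  evolves (m * 2) (D 0) (ncopy 2 w) (D (size w)).
Proof.
elim: w m D => [|e w IH] m D //= wfew H; have /andP[ok wfw] := wfew.
have [wfe we] := copies_wf 2 ok.
rewrite /ncopy /=; apply: (@evolves_cat _ _ _ (D 1)); last 1 first.
- by rewrite we; apply: (IH _ (fun l => D l.+1)) => // l lw; exact: (H l.+1).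
- by have [] := @ncopy_wf 2 m (e :: w) wfew.
exact: (H 0).
Qed.

(** The doubled matchings, with the marks of [marks_exist], are joined along the
    events of the two-copy; the crossing of the pattern changes the marks of the
    pair of the base point from [tL] to [tR]. *)
Lemma satellite_ruling_exists (K : front 0) (o : strand K -> bool) (star : strand K)
    (rho : fiberwise K) : is_knot K -> is_ruling rho ->
  count is_right_cusp K <= #|[set i | is_switch rho i]| ->
  exists rho' : fiberwise (satellite o star A2), is_ruling rho'.
Proof.
move=> knotK rulK many; pose P := trace rho.
have wfK : wf 0 K by case: (K) => w /= /andP[].
have mP i : i <= size K -> matching (strands_at K i) (P i) by exact: trace_matching.
have rP i : i < size K -> ruled (nth event0 K i) (strands_at K i) (strands_at K i.+1)
    (P i) (P i.+1) by exact: trace_ruled.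
have many' : count is_right_cusp K <= count (switch_at K P) (iota 0 (size K)).
  apply: leq_trans many _; rewrite cardE /enum_mem size_filter -enumT.
  rewrite -val_enum_ord count_map; apply: sub_count => i.
  rewrite !inE /is_switch /switch_at event_atE /=.
  have := width_take_nth 0 (ltn_ord i).
  case: (nth event0 K i) => // k /= wS /respectsP c; apply/allP => j.
  rewrite mem_iota add0n /= => jw; rewrite -!trace_ord in c.
  by apply: (c j j) => //; rewrite [X in _ < X]wS.

have connP (Q : nat -> nat -> Prop) :
  (forall i j, i <= size K -> j < strands_at K i -> Q i (P i j) <-> Q i j) ->
  (forall i j j', i < size K -> j < strands_at K i -> j' < strands_at K i.+1 ->
     through (nth event0 K i) j j' -> Q i j <-> Q i.+1 j') ->
  forall i j i' j', i <= size K -> j < strands_at K i ->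
    i' <= size K -> j' < strands_at K i' -> Q i j -> Q i' j'.
  move=> Qp Qt i j i' j' iN jw iN' jw'.
  pose R (s : strand K) := Q (tag s) (tagged s).
  have glueR s t : glued s t -> R s <-> R t.
    case: s t => [i1 j1] [i2 j2] /orP[/existsP[l /and3P[/eqP /= e1 /eqP /= e2]]|].
      rewrite event_atE; move: j1 j2; rewrite e1 e2 => j1 j2.
      exact: (Qt l j1 j2 (ltn_ord l) (ltn_ord j1) (ltn_ord j2)).
    case/and3P=> /eqP /= e1 _ _; move: j1; rewrite e1 => j1.
    by have := ltn_ord j1; rewrite [X in _ < X](closed_width K).
  have cuspR s t : cusped s t -> R s <-> R t.
    case: s t => [i1 j1] [i2 j2] /existsP[l]; have lK := ltn_ord l.
    have := ruled_spec wfK mP rP lK; rewrite event_atE /R.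
    case: (nth event0 K l) => // k [] => [km wS pk _|km wS pk _]
        /and4P[/eqP e1 /eqP e2 /eqP e3 /eqP e4]; rewrite /= in e1 e2 e3 e4;
      rewrite /= e3 e4 e1 e2 -?pk; apply: iff_sym.
      by apply: (Qp l.+1) => //; lia.
    by apply: (Qp l); [exact: ltnW | lia].
  have adjR s t : adjacent s t -> R s <-> R t.
    case/or4P => [/glueR|/glueR|/cuspR|/cuspR] // h; exact: iff_sym.
  have pathR s p : path (@adjacent 0 K) s p -> R s -> R (last s p).
    by elim: p s => //= t p IH s /andP[/adjR st /IH h] /st.
  pose s : strand K := Tagged (fun i => 'I_(nstrands i))
    (Ordinal (jw : j < nstrands (Ordinal (iN : i < (size K).+1)))).
  pose s' : strand K := Tagged (fun i => 'I_(nstrands i))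
    (Ordinal (jw' : j' < nstrands (Ordinal (iN' : i' < (size K).+1)))).
  move=> Qij; have /andP[_ /forallP/(_ s)/forallP/(_ s')/connectP[p sp e]] := knotK.
  by have := pathR s p sp Qij; rewrite -e.
pose i0 : nat := tag star; pose a : nat := tagged star.
have i0N : i0 <= size K by rewrite -ltnS ltn_ord.
have aw : a < strands_at K i0 by exact: ltn_ord.
have [tL [tR [typ same star_type trans]]] :=
  marks_exist wfK mP rP (closed_width K) many' connP i0N aw.
have step_evolves i : i < size K -> evolves (strands_at K i * 2)
    (doubled (P i) (tR i)) (copies 2 (nth event0 K i)) (doubled (P i.+1) (tL i.+1)).
  move=> iN; have [w1 w2] := (ltnW iN, iN).
  have := ruled_spec wfK mP rP iN; have := trans i iN; rewrite /transition.
  have [[_ tp] [tp' _]] := (typ i w1, typ i.+1 w2).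
  have [mp mp'] := (mP i w1, mP i.+1 w2).
  case: (nth event0 K i) => k.
  - move=> [uk ut] [km wS qk qp]; rewrite wS in mp' tp'.
    exact: evolves_copies_left.
  - move=> [tk ut] [km wS pk qp]; rewrite wS in ut qp.
    by apply: evolves_copies_right => // j jw; rewrite qp.
  case: ifP => _ tr [km wS pk]; last first.
    by move=> qp; apply: evolves_copies_unswitched.
  move=> [sw qp]; rewrite wS in tp'.
  have up : pair_invariant (strands_at K i) (P i) (tL i.+1) by move=> j jm; rewrite -qp ?tp'.
  have [ut [[u1 u2]|[u1 u2]]] := tr; last exact: evolves_copies_flipped.
  apply: evolves_copies_kept => // j jm.
  have [->//|/eqP jk] := eqVneq j k.
  have [->//|/eqP jk1] := eqVneq j k.+1.
  have [->|/eqP jpk] := eqVneq j (P i k); first by rewrite up ?tp // ltnW.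
  have [->|/eqP jpk1] := eqVneq j (P i k.+1); first by rewrite up ?tp.
  exact: ut.
have same' i : i <= size K -> i <> i0 -> forall j, j < strands_at K i -> tL i j = tR i j.
  by move=> iN ii0 j jw; apply: same => //; apply/negP => /eqP[].
have leftL i : i < size K -> i <> i0 -> evolves (strands_at K i * 2)
    (doubled (P i) (tL i)) (copies 2 (nth event0 K i)) (doubled (P i.+1) (tL i.+1)).
  move=> iK ii0; have [wfe _] := copies_wf 2 (wf_nth wfK iK).
  apply: evolves_extl (step_evolves i iK) => // x xw.
  by rewrite /doubled same' //; [exact: ltnW | lia].
have [wf1 wf2] : wf 0 (take i0 K) /\ wf (strands_at K i0) (drop i0 K).
  by apply/andP; rewrite -wf_cat cat_take_drop.
have [wfn1 wn1] := ncopy_wf 2 wf1; have [wfn2 wn2] := ncopy_wf 2 wf2.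
have K1 : evolves 0 id (ncopy 2 (take i0 K)) (doubled (P i0) (tL i0)).
  rewrite -[in doubled _ _](size_takel i0N).
  apply: (evolves_extl (p := doubled (P 0) (tL 0))) => //.
  apply: (@evolves_ncopy 0 _ (fun i => doubled (P i) (tL i))) => // l.
  rewrite size_takel // => li0; rewrite nth_take // take_takel ?(ltnW li0) //.
  by apply: leftL; [exact: leq_trans i0N | move=> li; rewrite li ltnn in li0].
(* The first interval right of the pattern carries the marks [tR]; on all later
   ones [tL] and [tR] agree. *)
pose D l := doubled (P (i0 + l)) (if l is 0 then tR i0 else tL (i0 + l)).
have K2 : evolves (strands_at K i0 * 2) (doubled (P i0) (tR i0)) (ncopy 2 (drop i0 K))
    (D (size (drop i0 K))).
  have -> : doubled (P i0) (tR i0) = D 0 by rewrite /D addn0.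
  apply: evolves_ncopy => // l; rewrite size_drop => lK.
  rewrite nth_drop -width_cat -takeD /D addnS; case: l lK => [|l] lK.
    by rewrite addn0; apply: step_evolves; rewrite -subn_gt0.
  apply: leftL; first by rewrite -ltn_subRL.
  by move/eqP; rewrite -[X in _ == X]addn0 eqn_add2l.
have wfS : wf 0 (satellite_events o star A2).
  by have /andP[] := satellite_subproof o star A2.
have eS : evolves 0 id (satellite_events o star A2) (D (size (drop i0 K))).
  rewrite /satellite_events; apply: evolves_cat K1 _ => //.
  rewrite wn1.
  have -> : map (lower_event (2 * tagged star)) (pattern o star A2) = [:: Crossing a.*2].
    by rewrite /pattern; case: (o star); rewrite /= addn0 mul2n.
  have [tp up] := typ i0 i0N.
  apply: evolves_satellite_crossing K2 wfn2 => //; first exact: mP.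
  move=> j jw ja jpa; symmetry; apply: same => //; apply/negP => /eqP[rja].
  have [_ pj _] := mP i0 i0N j jw; have [_ pa _] := mP i0 i0N a aw.
  move: rja; have [->|->] := rep_or P i0 j; have [->|->] := rep_or P i0 a => // e.
    by apply: jpa; rewrite -e pj.
  by apply: ja; rewrite -pj e pa.
have m0 : matching 0 id by [].
have [P' [_ mP' rP']] := trace_of_evolves m0 eS.
exact: (ruling_of_trace (F := satellite o star A2) (P := P')).
Qed.

(** The two strands of the pattern are necessarily paired, and paired strands must
    not cross. *)
Lemma no_ruling_A2 (rho : fiberwise A2) : ~~ is_ruling rho.
Proof.
pose i : 'I_(size A2) := @Ordinal 1 0 isT; pose b := before i.
have b0 : 0 < nstrands b by [].
apply/negP => /and3P[/forallP/(_ b)/forallP/(_ (Ordinal b0))/andP[_ /eqP n0] _].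
move=> /forallP/(_ i)/and3P[/negP np _ _]; apply: np.
rewrite pairedE // (extE _ b0) -/b.
have : rho b (Ordinal b0) < 2 by exact: ltn_ord.
case E : (nat_of_ord (rho b (Ordinal b0))) => [|[|r]] // _.
by case: n0; apply/val_inj.
Qed.

(** Each ruling contributes a monomial with coefficient [1], so the sum of the
    coefficients detects whether there is a ruling. *)
Lemma deg_ruling_poly m (F : front m) :
  deg (ruling_poly F) = (#|[pred rho : fiberwise F | is_ruling rho]|%:Z)%R.
Proof.
rewrite /ruling_poly (big_morph _ (@degD _) (@deg0 _)).
rewrite (eq_bigr (fun=> 1%R)) => [|rho _]; last exact: degU.
by rewrite GRing.sumr_const natz.
Qed.

Lemma ruling_of_ldeg (m : nat) (F : front m) : (0 <= ldeg (ruling_poly F))%E ->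
  exists2 rho : fiberwise F, is_ruling rho & (0 <= jdeg rho)%R.
Proof.
rewrite /ldeg => h.
have [d dd d0] : exists2 d, d \in dom (ruling_poly F) & (0 <= d)%R.
  elim: (dom _) h => [|d s IH]; first by rewrite big_nil.
  rewrite big_cons Order.TotalTheory.le_max => /orP[|/IH[d' d's d'0]].
    by rewrite lee_fin => ?; exists d; rewrite ?mem_head.
  by exists d' => //; rewrite inE d's orbT.
have /flattenP[s /mapP[rho + ->]] := dom_sum_subset dd.
rewrite mem_filter => /andP[rul _]; rewrite domU1 inE => /eqP dE.
by exists rho => //; rewrite -dE.
Qed.

Theorem theorem5p4 (K : front 0) (o : strand K -> bool) (star : strand K)
    (knotK : is_knot K) (orientK : is_orientation o)
    (degK : (0 <= ldeg (ruling_poly K))%E) :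
  compatible o star A2.
Proof.
have [rho rulK jK] := ruling_of_ldeg degK.
have [|rho' rul'] := @satellite_ruling_exists K o star rho knotK rulK.
  by move: jK; rewrite /jdeg Num.Theory.subr_ge0 lez_nat.
move=> /(congr1 (@deg _)); rewrite !deg_ruling_poly => -[].
rewrite [in RHS]eq_card0 => [/card0_eq/(_ rho')|r]; first by rewrite inE rul'.
by rewrite inE; apply/negbTE/no_ruling_A2.
Qed.
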